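(* Let $z_0\in T$ and $k\in\{0,1,2,\dots\}\cup\{\infty\}$. Then $U_5(T,z_0,k)$ is a dense $G_\delta$ subset of $C^k(T)$.
   Context: $T=\{|z|=1\}$, $D(z_0,r)$ the open disk of center $z_0$ and radius $r$. For $k\in\{0,1,2,\dots\}\cup\{\infty\}$, $C^k(T)$ is the space of $u:T\to\mathbb{C}$ such that $\theta\mapsto u(e^{i\theta})$ is $k$ times continuously differentiable on $\mathbb{R}$, with the topology given by the seminorms $\sup_{\theta\in\mathbb{R}}|\frac{d^l}{d\theta^l}u(e^{i\theta})|$ for all integers $0\le l\le k$. $U_5(T,z_0,k)$ is the set of $u\in C^k(T)$ for which there exist no $r>0$ and no holomorphic $F:D(z_0,r)\to\mathbb{C}$ with $F=u$ on $D(z_0,r)\cap T$. *)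

(* Defs.v *)
From Stdlib Require Import Reals.
Open Scope R_scope.

Definition Cx : Type := (R * R)%type.
Definition Cadd (z w : Cx) : Cx := (fst z + fst w, snd z + snd w).
Definition Csub (z w : Cx) : Cx := (fst z - fst w, snd z - snd w).
Definition Cmul (z w : Cx) : Cx :=
  (fst z * fst w - snd z * snd w, fst z * snd w + snd z * fst w).
Definition Cnorm (z : Cx) : R := sqrt (fst z * fst z + snd z * snd z).

Definition expi (t : R) : Cx := (cos t, sin t).

Definition in_disk (z0 : Cx) (r : R) (z : Cx) : Prop := Cnorm (Csub z z0) < r.

(* F is holomorphic (complex differentiable at every point) on D(z0, r);
   values of F outside the disk are irrelevant. *)
Definition holomorphic_on_disk (z0 : Cx) (r : R) (F : Cx -> Cx) : Prop :=
  forall z, in_disk z0 r z ->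
    exists c : Cx, forall eps, 0 < eps -> exists delta, 0 < delta /\
      forall h : Cx, 0 < Cnorm h < delta ->
        Cnorm (Csub (Csub (F (Cadd z h)) (F z)) (Cmul c h)) <= eps * Cnorm h.

Inductive ext_nat : Type := Fin (n : nat) | Inf.
Definition le_ext (l : nat) (k : ext_nat) : Prop :=
  match k with Fin n => (l <= n)%nat | Inf => True end.

Definition is_deriv (g h : R -> Cx) : Prop :=
  forall x, derivable_pt_lim (fun t => fst (g t)) x (fst (h x)) /\
            derivable_pt_lim (fun t => snd (g t)) x (snd (h x)).

Inductive nth_deriv : nat -> (R -> Cx) -> (R -> Cx) -> Prop :=
| nth_deriv0 (g : R -> Cx) : nth_deriv 0 g g
| nth_derivS (l : nat) (g h h' : R -> Cx) :
    nth_deriv l g h -> is_deriv h h' -> nth_deriv (S l) g h'.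

Definition Ccontinuous (h : R -> Cx) : Prop :=
  continuity (fun t => fst (h t)) /\ continuity (fun t => snd (h t)).

(* An element u of Cx^k(T) is represented by g(theta) = u(e^{i theta}),
   a 2pi-periodic function R -> Cx which is k times continuously differentiable. *)
Definition CkT (k : ext_nat) (g : R -> Cx) : Prop :=
  (forall t, g (t + 2 * PI) = g t) /\
  (forall l, le_ext l k -> exists h, nth_deriv l g h /\ Ccontinuous h).

Definition ck_ball (k : ext_nat) (u : R -> Cx) (N : nat) (eps : R) (v : R -> Cx) : Prop :=
  forall l, (l <= N)%nat -> le_ext l k ->
    exists h, nth_deriv l (fun t => Csub (v t) (u t)) h /\
      exists M, M < eps /\ forall t, Cnorm (h t) <= M.

(* Topology of Cx^k(T) given by the seminorms; subsets are predicates,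
   considered relative to the carrier CkT k. *)
Definition open_in_Ck (k : ext_nat) (A : (R -> Cx) -> Prop) : Prop :=
  forall u, CkT k u -> A u ->
    exists (N : nat) (eps : R), 0 < eps /\
      forall v, CkT k v -> ck_ball k u N eps v -> A v.

Definition dense_in_Ck (k : ext_nat) (A : (R -> Cx) -> Prop) : Prop :=
  forall O, open_in_Ck k O -> (exists u, CkT k u /\ O u) ->
    exists u, CkT k u /\ O u /\ A u.

Definition Gdelta_in_Ck (k : ext_nat) (A : (R -> Cx) -> Prop) : Prop :=
  exists O : nat -> (R -> Cx) -> Prop,
    (forall n, open_in_Ck k (O n)) /\
    (forall u, CkT k u -> (A u <-> forall n, O n u)).

Definition U5 (z0 : Cx) (k : ext_nat) (u : R -> Cx) : Prop :=
  CkT k u /\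
  ~ (exists r, 0 < r /\ exists F : Cx -> Cx, holomorphic_on_disk z0 r F /\
       forall t, in_disk z0 r (expi t) -> F (expi t) = u t).

(* Main.v *)
Require Import Defs.
From Stdlib Require Import Reals Arith Lra Lia Psatz Classical IndefiniteDescription FunctionalExtensionality.
From Coquelicot Require Import Coquelicot.
Open Scope R_scope.

(** By Cauchy's theorem, u extends holomorphically near z0 iff for some integer
    M >= 1 it has a power series expansion in z - z0 on the arc |z - z0| < 1/(8M)
    with n-th coefficient at most M^(n+1) and geometric remainders. For fixed M
    these u form a closed set, already for uniform convergence, because a
    function that is small on the arc has small coefficients (with a rate
    depending only on M and on the index); hence U5 is a G_delta. For density,
    if u is extendable then u + c g is not, for every c > 0, where
    g(t) = exp(-1/(1 - cos(t - t0))) is smooth, flat at t0 and nonzero nearby: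
    otherwise g would have an expansion, with all coefficients zero. *)

(** * Closed differentiable forms on rectangles *)

(** Holomorphy means here only that a derivative exists at each point, so Cauchy's theorem has to
    come from a Goursat argument. That argument is run on rectangles of the real plane only: the
    disk is parametrised by (l, t) -> w + l (e^{it} - w), a holomorphic function pulls back to a
    pair of closed real forms in (l, t), and the sides t = 0 and t = 2 PI cancel by periodicity.
    Extendability is expressed through polynomial remainders rather than through F, because for
    fixed t and N the remainder inequality involves finitely many coefficients and passes to the
    limit. One number M serves as coefficient bound, growth rate and inverse radius, so that its
    integer values give countably many closed sets. The 8 in the radius R = 1/(8M) pays for
    term-by-term differentiation: the second-order error of z^n costs a factor n^2 <= 4^n, and 4 M R
    = 1/2 is still a convergent geometric ratio. *)

Definition boundary_integral (P Q : R -> R -> R) (a b c d : R) : R :=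
  RInt (fun x => P x c) a b - RInt (fun x => P x d) a b
  + RInt (Q b) c d - RInt (Q a) c d.

(** Closedness of P dx + Q dy is encoded by the shared [p2], which is both the y-derivative of P and
    the x-derivative of Q. Differentiability is total, but at this point only. *)
Definition closed_form_at (P Q : R -> R -> R) (x y : R) : Prop :=
  exists p1 p2 q2,
    differentiable_pt_lim P x y p1 p2 /\ differentiable_pt_lim Q x y p2 q2.

Lemma differentiable_pt_lim_sections (f : R -> R -> R) (x y l1 l2 : R) :
  differentiable_pt_lim f x y l1 l2 ->
  continuous (fun u => f u y) x /\ continuous (f x) y.
Proof.
  intros H.
  split; apply (ex_derive_continuous (V := R_NormedModule)).
  - exists (l1 * 1 + l2 * 0). apply is_derive_Reals.
    apply (derivable_pt_lim_comp_2d f (fun u => u) (fun _ => y)).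
    + exact H.
    + apply derivable_pt_lim_id.
    + apply derivable_pt_lim_const.
  - exists (l1 * 0 + l2 * 1). apply is_derive_Reals.
    apply (derivable_pt_lim_comp_2d f (fun _ => x) (fun u => u)).
    + exact H.
    + apply derivable_pt_lim_const.
    + apply derivable_pt_lim_id.
Qed.

Lemma ex_RInt_continuous_le (f : R -> R) (a b : R) :
  a <= b -> (forall x, a <= x <= b -> continuous f x) -> ex_RInt f a b.
Proof.
  intros hab H. apply (ex_RInt_continuous (V := R_CompleteNormedModule)).
  intros z. rewrite Rmin_left, Rmax_right by lra. apply H.
Qed.

Lemma RInt_near_const (f : R -> R) (a b k e : R) :
  a <= b -> ex_RInt f a b -> (forall x, a <= x <= b -> Rabs (f x - k) <= e) ->
  Rabs (RInt f a b - k * (b - a)) <= e * (b - a).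
Proof.
  intros hab hf H.
  assert (hc : ex_RInt (fun _ => k) a b) by apply ex_RInt_const.
  replace (RInt f a b - k * (b - a)) with (RInt (fun x => f x - k) a b).
  - rewrite (Rmult_comm e). apply abs_RInt_le_const; auto.
    apply (ex_RInt_minus (V := R_NormedModule) f (fun _ => k)); auto.
  - rewrite (RInt_minus (V := R_CompleteNormedModule) f (fun _ => k)) by auto.
    rewrite RInt_const. unfold minus, plus, opp, scal; simpl; unfold mult; simpl. ring.
Qed.

Lemma RInt_split_R (f : R -> R) (a m b : R) :
  a <= m <= b -> (forall x, a <= x <= b -> continuous f x) ->
  RInt f a b = RInt f a m + RInt f m b.
Proof.
  intros hm H. symmetry. apply (RInt_Chasles (V := R_CompleteNormedModule));
  apply ex_RInt_continuous_le; try lra; intros; apply H; lra.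
Qed.

Section Rectangle.
Variables (P Q : R -> R -> R) (a b c d : R).
Hypothesis closed_PQ :
  forall x y, a <= x <= b -> c <= y <= d -> closed_form_at P Q x y.

Lemma closed_continuous_P (x y : R) :
  a <= x <= b -> c <= y <= d -> continuous (fun u => P u y) x.
Proof.
  intros hx hy. destruct (closed_PQ x y hx hy) as (p1 & p2 & q2 & h1 & _).
  exact (proj1 (differentiable_pt_lim_sections _ _ _ _ _ h1)).
Qed.

Lemma closed_continuous_Q (x y : R) :
  a <= x <= b -> c <= y <= d -> continuous (Q x) y.
Proof.
  intros hx hy. destruct (closed_PQ x y hx hy) as (p1 & p2 & q2 & _ & h2).
  exact (proj2 (differentiable_pt_lim_sections _ _ _ _ _ h2)).
Qed.

Lemma boundary_integral_split (x1 x2 x3 y1 y2 y3 : R) :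
  a <= x1 -> x1 <= x2 <= x3 -> x3 <= b -> c <= y1 -> y1 <= y2 <= y3 -> y3 <= d ->
  boundary_integral P Q x1 x3 y1 y3 =
    boundary_integral P Q x1 x2 y1 y2 + boundary_integral P Q x2 x3 y1 y2
    + boundary_integral P Q x1 x2 y2 y3 + boundary_integral P Q x2 x3 y2 y3.
Proof.
  intros. unfold boundary_integral.
  rewrite (RInt_split_R (fun x => P x y1) x1 x2 x3),
    (RInt_split_R (fun x => P x y3) x1 x2 x3),
    (RInt_split_R (Q x1) y1 y2 y3), (RInt_split_R (Q x3) y1 y2 y3);
    try lra; intros;
    first [apply closed_continuous_P | apply closed_continuous_Q]; lra.
Qed.

(** The affine part of a closed form integrates to zero around a rectangle, since the two
    contributions of [p2] cancel. What is left is the differentiability error: at most eps s on each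
    of four sides of length at most s. *)
Lemma boundary_integral_small (x0 y0 eps : R) :
  0 < eps -> a <= x0 <= b -> c <= y0 <= d ->
  exists delta, 0 < delta /\ forall x1 x2 y1 y2 s,
    a <= x1 -> x1 <= x0 <= x2 -> x2 <= b -> c <= y1 -> y1 <= y0 <= y2 -> y2 <= d ->
    x2 - x1 <= s -> y2 - y1 <= s -> s < delta ->
    Rabs (boundary_integral P Q x1 x2 y1 y2) <= 4 * eps * s ^ 2.
Proof.
  intros heps hx0 hy0.
  destruct (closed_PQ x0 y0 hx0 hy0) as (p1 & p2 & q2 & h1 & h2).
  destruct (h1 (mkposreal eps heps)) as [d1 H1].
  destruct (h2 (mkposreal eps heps)) as [d2 H2].
  exists (Rmin d1 d2). split. { apply Rmin_pos; apply cond_pos. }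
  intros x1 x2 y1 y2 s hx1 hx hx2 hy1 hy hy2 hxs hys hs.
  assert (hs1 : s < d1) by (eapply Rlt_le_trans; [exact hs | apply Rmin_l]).
  assert (hs2 : s < d2) by (eapply Rlt_le_trans; [exact hs | apply Rmin_r]).
  assert (abs_le : forall u v w, u <= v <= w -> u <= x0 <= w -> w - u <= s -> Rabs (v - x0) <= s)
    by (intros; apply Rabs_le; lra).
  assert (abs_le' : forall u v w, u <= v <= w -> u <= y0 <= w -> w - u <= s -> Rabs (v - y0) <= s)
    by (intros; apply Rabs_le; lra).
  assert (B1 : forall x y, x1 <= x <= x2 -> y1 <= y <= y2 ->
    Rabs (P x y - P x0 y0 - (p1 * (x - x0) + p2 * (y - y0))) <= eps * s).
  { intros x y h h'.
    assert (e1 := abs_le x1 x x2 h hx hxs). assert (e2 := abs_le' y1 y y2 h' hy hys).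
    eapply Rle_trans; [apply H1; lra|]. simpl.
    apply Rmult_le_compat_l; [lra|]. now apply Rmax_lub. }
  assert (B2 : forall x y, x1 <= x <= x2 -> y1 <= y <= y2 ->
    Rabs (Q x y - Q x0 y0 - (p2 * (x - x0) + q2 * (y - y0))) <= eps * s).
  { intros x y h h'.
    assert (e1 := abs_le x1 x x2 h hx hxs). assert (e2 := abs_le' y1 y y2 h' hy hys).
    eapply Rle_trans; [apply H2; lra|]. simpl.
    apply Rmult_le_compat_l; [lra|]. now apply Rmax_lub. }
  assert (EP : forall y, y1 <= y <= y2 -> ex_RInt (fun x => P x y) x1 x2).
  { intros. apply ex_RInt_continuous_le; [lra|]. intros. apply closed_continuous_P; lra. }
  assert (EQ : forall x, x1 <= x <= x2 -> ex_RInt (Q x) y1 y2).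
  { intros. apply ex_RInt_continuous_le; [lra|]. intros. apply closed_continuous_Q; lra. }
  (* Between the bottom and the top side the terms in [p1] cancel; only the slope [p2] in y
     survives. *)
  assert (IP : Rabs (RInt (fun x => P x y1) x1 x2 - RInt (fun x => P x y2) x1 x2
      - (p2 * (y1 - y2)) * (x2 - x1)) <= 2 * (eps * s) * (x2 - x1)).
  { rewrite <- (RInt_minus (V := R_CompleteNormedModule) (fun x => P x y1) (fun x => P x y2))
      by (apply EP; lra).
    apply RInt_near_const; [lra| |].
    - apply (ex_RInt_minus (V := R_NormedModule)); apply EP; lra.
    - intros x hxx. unfold minus, plus, opp; simpl.
      assert (t1 := B1 x y1 hxx ltac:(lra)). assert (t2 := B1 x y2 hxx ltac:(lra)).
      apply Rabs_le. apply Rabs_le_between in t1. apply Rabs_le_between in t2. lra. }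
  assert (IQ : Rabs (RInt (Q x2) y1 y2 - RInt (Q x1) y1 y2
      - (p2 * (x2 - x1)) * (y2 - y1)) <= 2 * (eps * s) * (y2 - y1)).
  { rewrite <- (RInt_minus (V := R_CompleteNormedModule) (Q x2) (Q x1))
      by (apply EQ; lra).
    apply RInt_near_const; [lra| |].
    - apply (ex_RInt_minus (V := R_NormedModule)); apply EQ; lra.
    - intros y hyy. unfold minus, plus, opp; simpl.
      assert (t1 := B2 x1 y ltac:(lra) hyy). assert (t2 := B2 x2 y ltac:(lra) hyy).
      apply Rabs_le. apply Rabs_le_between in t1. apply Rabs_le_between in t2. lra. }
  assert (es : 0 <= eps * s) by nra.
  assert (J1 : 2 * (eps * s) * (x2 - x1) <= 2 * (eps * s) * s) by (apply Rmult_le_compat_l; lra).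
  assert (J2 : 2 * (eps * s) * (y2 - y1) <= 2 * (eps * s) * s) by (apply Rmult_le_compat_l; lra).
  apply Rabs_le. apply Rabs_le_between in IP. apply Rabs_le_between in IQ.
  unfold boundary_integral. split; nra.
Qed.

Definition cell_integral (n : nat) (p : R * R) : R :=
  boundary_integral P Q (fst p) (fst p + (b - a) / 2 ^ n)
                        (snd p) (snd p + (d - c) / 2 ^ n).

Definition cell_inside (n : nat) (p : R * R) : Prop :=
  a <= fst p /\ fst p + (b - a) / 2 ^ n <= b /\
  c <= snd p /\ snd p + (d - c) / 2 ^ n <= d.

Definition subcell (n : nat) (p q : R * R) : Prop :=
  (fst p <= fst q /\ fst q + (b - a) / 2 ^ S n <= fst p + (b - a) / 2 ^ n) /\
  (snd p <= snd q /\ snd q + (d - c) / 2 ^ S n <= snd p + (d - c) / 2 ^ n).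

(** The boundary integral of a cell is the sum of those of its four quarters, so one quarter carries
    at least a fourth of its absolute value. *)
Lemma subcell_exists (n : nat) (p : R * R) :
  a <= b -> c <= d -> cell_inside n p ->
  exists q, subcell n p q /\ Rabs (cell_integral n p) <= 4 * Rabs (cell_integral (S n) q).
Proof.
  intros hab hcd (h1 & h2 & h3 & h4).
  unfold subcell, cell_integral.
  set (L := (b - a) / 2 ^ S n). set (H := (d - c) / 2 ^ S n).
  assert (p2 : 0 < 2 ^ n) by (apply pow_lt; lra).
  assert (eL : (b - a) / 2 ^ n = L + L) by (unfold L; simpl; field; lra).
  assert (eH : (d - c) / 2 ^ n = H + H) by (unfold H; simpl; field; lra).
  assert (pL : 0 <= L).
  { apply Rmult_le_pos; [lra|]. left. apply Rinv_0_lt_compat, pow_lt; lra. }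
  assert (pH : 0 <= H).
  { apply Rmult_le_pos; [lra|]. left. apply Rinv_0_lt_compat, pow_lt; lra. }
  rewrite eL in *. rewrite eH in *. destruct p as [x y]; simpl fst in *; simpl snd in *.
  rewrite (boundary_integral_split x (x + L) (x + (L + L)) y (y + H) (y + (H + H))) by lra.
  replace (x + (L + L)) with (x + L + L) by ring.
  replace (y + (H + H)) with (y + H + H) by ring.
  set (w1 := boundary_integral P Q x (x + L) y (y + H)).
  set (w2 := boundary_integral P Q (x + L) (x + L + L) y (y + H)).
  set (w3 := boundary_integral P Q x (x + L) (y + H) (y + H + H)).
  set (w4 := boundary_integral P Q (x + L) (x + L + L) (y + H) (y + H + H)).
  assert (tri : Rabs (w1 + w2 + w3 + w4) <= Rabs w1 + Rabs w2 + Rabs w3 + Rabs w4).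
  { assert (t1 := Rabs_triang (w1 + w2 + w3) w4). assert (t2 := Rabs_triang (w1 + w2) w3).
    assert (t3 := Rabs_triang w1 w2). lra. }
  destruct (Rle_dec (Rabs (w1 + w2 + w3 + w4)) (4 * Rabs w1)) as [k1|k1].
  { exists (x, y). simpl fst; simpl snd. split; [lra|exact k1]. }
  destruct (Rle_dec (Rabs (w1 + w2 + w3 + w4)) (4 * Rabs w2)) as [k2|k2].
  { exists (x + L, y). simpl fst; simpl snd. split; [lra|exact k2]. }
  destruct (Rle_dec (Rabs (w1 + w2 + w3 + w4)) (4 * Rabs w3)) as [k3|k3].
  { exists (x, y + H). simpl fst; simpl snd. split; [lra|exact k3]. }
  exists (x + L, y + H). simpl fst; simpl snd. split; [lra|]. fold w4. lra.
Qed.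

(** Nested intervals: z is the supremum of the left ends, and every right end bounds all the left
    ends from above. *)
Lemma nested_corner_limit (x : nat -> R) (u : R) :
  0 <= u ->
  (forall n, x n <= x (S n) /\ x (S n) + u / 2 ^ S n <= x n + u / 2 ^ n) ->
  exists z, forall n, x n <= z <= x n + u / 2 ^ n.
Proof.
  intros hu H.
  assert (pos : forall n, 0 <= u / 2 ^ n).
  { intros n. apply Rmult_le_pos; [lra|]. left. apply Rinv_0_lt_compat, pow_lt; lra. }
  assert (up : forall k n, x n <= x (n + k)%nat /\ x (n + k)%nat + u / 2 ^ (n + k) <= x n + u / 2 ^ n).
  { induction k as [|k IH]; intros n.
    - rewrite Nat.add_0_r. lra.
    - rewrite Nat.add_succ_r. destruct (IH n). destruct (H (n + k)%nat). lra. }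
  assert (ub : forall n m, x m <= x n + u / 2 ^ n).
  { intros n m. destruct (Nat.le_ge_cases n m) as [h|h].
    - replace m with (n + (m - n))%nat by lia. destruct (up (m - n)%nat n).
      specialize (pos (n + (m - n))%nat). lra.
    - replace n with (m + (n - m))%nat by lia. destruct (up (n - m)%nat m).
      specialize (pos (m + (n - m))%nat). lra. }
  destruct (completeness (fun y => exists n, y = x n)) as [z [hz1 hz2]].
  - exists (x 0%nat + u / 2 ^ 0). intros y [n ->]. apply ub.
  - now exists (x 0%nat), 0%nat.
  - exists z. intros n. split.
    + apply hz1. now exists n.
    + apply hz2. intros y [m ->]. apply ub.
Qed.

(* Goursat's bisection argument: no continuity of the partial derivatives is needed. *)
Theorem boundary_integral_closed :
  a <= b -> c <= d -> boundary_integral P Q a b c d = 0.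
Proof.
  intros hab hcd.
  destruct (Req_dec (boundary_integral P Q a b c d) 0) as [E|NE]; [exact E|exfalso].
  set (W := Rabs (boundary_integral P Q a b c d)).
  assert (hW : 0 < W) by now apply Rabs_pos_lt.
  (* The choice ranges over all pairs (level, corner), with a vacuous condition on cells that stick
     out, so that [f] is total and can be iterated. *)
  destruct (functional_choice (fun (np : nat * (R * R)) q => cell_inside (fst np) (snd np) ->
      subcell (fst np) (snd np) q /\
      Rabs (cell_integral (fst np) (snd np)) <= 4 * Rabs (cell_integral (S (fst np)) q)))
    as [f hf].
  { intros [n p]. simpl. destruct (classic (cell_inside n p)) as [h|h].
    - destruct (subcell_exists n p hab hcd h) as [q hq]. now exists q.
    - exists p. intros; contradiction. }
  set (p := fix p n := match n with O => (a, c) | S n => f (n, p n) end).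
  assert (pS : forall n, p (S n) = f (n, p n)) by reflexivity.
  assert (inside : forall n, cell_inside n (p n)).
  { induction n as [|n IH].
    - unfold cell_inside; simpl. lra.
    - destruct (hf (n, p n) IH) as [[h1 h2] _]. simpl fst in *; simpl snd in *.
      rewrite <- pS in *. unfold cell_inside in *. lra. }
  assert (step : forall n, subcell n (p n) (p (S n)) /\
     Rabs (cell_integral n (p n)) <= 4 * Rabs (cell_integral (S n) (p (S n)))).
  { intros n. exact (hf (n, p n) (inside n)). }
  assert (low : forall n, W <= 4 ^ n * Rabs (cell_integral n (p n))).
  { induction n as [|n IH].
    - unfold cell_integral; simpl. rewrite !Rdiv_1_r, !Rplus_minus. fold W. lra.
    - destruct (step n) as [_ h]. change (4 ^ S n) with (4 * 4 ^ n).
      assert (0 < 4 ^ n) by (apply pow_lt; lra). nra. }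
  destruct (nested_corner_limit (fun n => fst (p n)) (b - a) (proj1 (Rminus_le_0 a b) hab)) as [x0 hx0];
    [apply step|].
  destruct (nested_corner_limit (fun n => snd (p n)) (d - c) (proj1 (Rminus_le_0 c d) hcd)) as [y0 hy0];
    [apply step|].
  (* A common bound for both sides; the added 1 keeps it positive when the rectangle is
     degenerate. *)
  set (s := (b - a) + (d - c) + 1). assert (hs : 0 < s) by (unfold s; lra).
  assert (ix : a <= x0 <= b) by (specialize (hx0 O); simpl in hx0; lra).
  assert (iy : c <= y0 <= d) by (specialize (hy0 O); simpl in hy0; lra).
  (* With this eps a cell of level n has integral at most 4 eps (s / 2^n)^2 = W / (2 * 4^n), half of
     the lower bound W / 4^n obtained by bisection. *)
  set (eps := W / (8 * s ^ 2)).
  assert (heps : 0 < eps) by (apply Rdiv_lt_0_compat; nra).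
  destruct (boundary_integral_small x0 y0 eps heps ix iy) as [delta [hd small]].
  destruct (pow_lt_1_zero (/ 2)) with (y := delta / s) as [n hn].
  { rewrite Rabs_pos_eq; lra. }
  { now apply Rdiv_lt_0_compat. }
  specialize (hn n (le_n n)).
  rewrite Rabs_pos_eq in hn by (apply pow_le; lra). rewrite pow_inv in hn.
  assert (p2 : 0 < / 2 ^ n) by (apply Rinv_0_lt_compat, pow_lt; lra).
  destruct (inside n) as (i1 & i2 & i3 & i4).
  specialize (small (fst (p n)) (fst (p n) + (b - a) / 2 ^ n)
                    (snd (p n)) (snd (p n) + (d - c) / 2 ^ n) (s / 2 ^ n)).
  assert (sm : s / 2 ^ n < delta).
  { apply (Rmult_lt_compat_r s) in hn; [|lra]. unfold Rdiv in *.
    rewrite Rmult_assoc, Rinv_l in hn by lra. lra. }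
  assert (Hs : Rabs (cell_integral n (p n)) <= 4 * eps * (s / 2 ^ n) ^ 2).
  { apply small; auto; unfold Rdiv.
    - replace (fst (p n) + (b - a) * / 2 ^ n - fst (p n)) with ((b - a) * / 2 ^ n) by ring.
      apply Rmult_le_compat_r; unfold s; lra.
    - replace (snd (p n) + (d - c) * / 2 ^ n - snd (p n)) with ((d - c) * / 2 ^ n) by ring.
      apply Rmult_le_compat_r; unfold s; lra. }
  specialize (low n).
  assert (q4 : 0 < 4 ^ n) by (apply pow_lt; lra).
  assert (E4 : 4 ^ n = 2 ^ n * 2 ^ n) by (rewrite <- Rpow_mult_distr; f_equal; lra).
  apply (Rmult_le_compat_l (4 ^ n)) in Hs; [|lra].
  replace (4 ^ n * (4 * eps * (s / 2 ^ n) ^ 2)) with (W / 2) in Hs.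
  - lra.
  - rewrite E4. unfold eps. field. split; [|lra].
    apply Rgt_not_eq, pow_lt; lra.
Qed.
End Rectangle.

(** * Complex differentiability and integrals over a period *)

Lemma differentiable_pt_lim_proj2_0 (f : R -> R) (x y l : R) :
  derivable_pt_lim f y l -> differentiable_pt_lim (fun _ v => f v) x y 0 l.
Proof.
  intros H eps.
  destruct (differentiable_pt_lim_proj1_0 f y x l H eps) as [d Hd].
  exists d. intros u v hu hv. specialize (Hd v u hv hu).
  rewrite Rmax_comm, (Rplus_comm (0 * _)). exact Hd.
Qed.

Lemma differentiable_pt_lim_plus (f g : R -> R -> R) (x y f1 f2 g1 g2 : R) :
  differentiable_pt_lim f x y f1 f2 -> differentiable_pt_lim g x y g1 g2 ->
  differentiable_pt_lim (fun u v => f u v + g u v) x y (f1 + g1) (f2 + g2).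
Proof.
  intros hf hg.
  replace (f1 + g1) with (1 * f1 + 1 * g1) by ring.
  replace (f2 + g2) with (1 * f2 + 1 * g2) by ring.
  apply (differentiable_pt_lim_comp (fun a b => a + b)); auto.
  intros eps. exists (mkposreal 1 Rlt_0_1). intros u v _ _.
  match goal with |- Rabs ?t <= _ => replace t with 0 by ring end.
  rewrite Rabs_R0. apply Rmult_le_pos; [left; apply cond_pos|].
  eapply Rle_trans; [apply Rabs_pos | apply Rmax_l].
Qed.

Lemma differentiable_pt_lim_mult (f g : R -> R -> R) (x y f1 f2 g1 g2 : R) :
  differentiable_pt_lim f x y f1 f2 -> differentiable_pt_lim g x y g1 g2 ->
  differentiable_pt_lim (fun u v => f u v * g u v) x y
    (g x y * f1 + f x y * g1) (g x y * f2 + f x y * g2).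
Proof.
  intros hf hg.
  apply (differentiable_pt_lim_comp (fun a b => a * b)); auto.
  intros eps. exists eps. intros u v hu hv.
  match goal with |- Rabs ?t <= _ =>
    replace t with ((u - f x y) * (v - g x y)) by ring end.
  rewrite Rabs_mult. apply Rmult_le_compat; try apply Rabs_pos; [lra | apply Rmax_r].
Qed.

Lemma differentiable_pt_lim_opp (f : R -> R -> R) (x y f1 f2 : R) :
  differentiable_pt_lim f x y f1 f2 ->
  differentiable_pt_lim (fun u v => - f u v) x y (- f1) (- f2).
Proof.
  intros hf eps. destruct (hf eps) as [d Hd]. exists d. intros u v hu hv.
  specialize (Hd u v hu hv). rewrite <- Rabs_Ropp in Hd.
  match type of Hd with Rabs ?s <= _ => match goal with |- Rabs ?t <= _ =>
    replace t with s by ring end end. exact Hd.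
Qed.

Lemma Cmod_le_abs (z : C) : Cmod z <= Rabs (fst z) + Rabs (snd z).
Proof.
  destruct z as [x y]. unfold Cmod; simpl fst; simpl snd.
  rewrite <- (sqrt_pow2 (Rabs x + Rabs y)).
  - apply sqrt_le_1_alt. rewrite <- (pow2_abs x), <- (pow2_abs y).
    assert (hx := Rabs_pos x). assert (hy := Rabs_pos y). nra.
  - assert (hx := Rabs_pos x). assert (hy := Rabs_pos y). lra.
Qed.

Lemma abs_fst_le_Cmod (z : C) : Rabs (fst z) <= Cmod z.
Proof. eapply Rle_trans; [apply Rmax_l | apply Rmax_Cmod]. Qed.

Lemma abs_snd_le_Cmod (z : C) : Rabs (snd z) <= Cmod z.
Proof. eapply Rle_trans; [apply Rmax_r | apply Rmax_Cmod]. Qed.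

(** The condition of [holomorphic_on_disk] at a single point, with the library's operations. [Cx]
    and [C] are convertible, and so are [Csub] and [Cminus], which the later [change] steps use. *)
Definition hol_at (G : C -> C) (z : C) : Prop :=
  exists c : C, forall eps, 0 < eps -> exists delta, 0 < delta /\
    forall h : C, 0 < Cmod h < delta ->
      Cmod (G (z + h) - G z - c * h)%C <= eps * Cmod h.

(** The Cauchy-Riemann equations: multiplication by c1 + i c2 is the real matrix with rows (c1, -c2)
    and (c2, c1). The modulus is at most twice the sup norm, whence eps / 2 and d / 2. *)
Lemma hol_at_differentiable (G : C -> C) (x y : R) :
  hol_at G (x, y) ->
  exists c1 c2,
    differentiable_pt_lim (fun u v => fst (G (u, v))) x y c1 (- c2) /\
    differentiable_pt_lim (fun u v => snd (G (u, v))) x y c2 c1.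
Proof.
  intros [[c1 c2] H]. exists c1, c2.
  assert (K : forall eps : posreal, locally_2d (fun u v =>
    Cmod (G (u, v) - G (x, y) - (c1, c2) * (u - x, v - y)%R)%C
      <= eps * Rmax (Rabs (u - x)) (Rabs (v - y))) x y).
  { intros eps. destruct (H (eps / 2)) as [d [hd Hd]].
    { assert (e := cond_pos eps). lra. }
    assert (hd2 : 0 < d / 2) by lra.
    exists (mkposreal _ hd2). simpl. intros u v hu hv.
    assert (B := Cmod_le_abs (u - x, v - y)%R). simpl in B.
    destruct (Req_dec (Cmod (u - x, v - y)%R) 0) as [E|NE].
    - assert (E' := Cmod_eq_0 _ E). injection E' as E1 E2.
      replace u with x by lra. replace v with y by lra.
      match goal with |- Cmod ?t <= _ => replace t with (RtoC 0) end.
      + rewrite Cmod_0. apply Rmult_le_pos; [left; apply cond_pos|].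
        eapply Rle_trans; [apply Rabs_pos | apply Rmax_l].
      + rewrite !Rminus_diag. change (0, 0) with (RtoC 0). ring.
    - specialize (Hd (u - x, v - y)%R).
      replace ((x, y) + (u - x, v - y)%R)%C with (u, v) in Hd
        by (unfold Cplus; simpl; f_equal; ring).
      eapply Rle_trans; [apply Hd|].
      + split; [|lra]. assert (0 <= Cmod (u - x, v - y)%R) by apply Cmod_ge_0. lra.
      + assert (m1 := Rmax_l (Rabs (u - x)) (Rabs (v - y))).
        assert (m2 := Rmax_r (Rabs (u - x)) (Rabs (v - y))).
        assert (e := cond_pos eps). nra. }
  split; intros eps; destruct (K eps) as [d Hd]; exists d; intros u v hu hv;
    (eapply Rle_trans; [|apply (Hd u v hu hv)]).
  - eapply Rle_trans; [|apply abs_fst_le_Cmod]. right. f_equal. simpl. ring.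
  - eapply Rle_trans; [|apply abs_snd_le_Cmod]. right. f_equal. simpl. ring.
Qed.

Lemma hol_at_continuous (G : C -> C) (z : C) :
  hol_at G z -> forall eps, 0 < eps -> exists delta, 0 < delta /\
    forall z', Cmod (z' - z) < delta -> Cmod (G z' - G z) <= eps.
Proof.
  intros [c H] eps he. destruct (H 1 Rlt_0_1) as [d [hd Hd]].
  assert (hc := Cmod_ge_0 c).
  assert (hk : 0 < eps / (1 + Cmod c)) by (apply Rdiv_lt_0_compat; lra).
  exists (Rmin d (eps / (1 + Cmod c))). split; [now apply Rmin_pos|].
  intros z' hz'.
  assert (h1 := Rlt_le_trans _ _ _ hz' (Rmin_l _ _)).
  assert (h2 := Rlt_le_trans _ _ _ hz' (Rmin_r _ _)).
  destruct (Req_dec (Cmod (z' - z)) 0) as [E|NE].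
  - apply Cmod_eq_0 in E. replace z' with z.
    + replace (G z - G z)%C with (RtoC 0) by ring. rewrite Cmod_0. lra.
    + replace z' with (z' - z + z)%C by ring. rewrite E. ring.
  - specialize (Hd (z' - z)%C). replace (z + (z' - z))%C with z' in Hd by ring.
    assert (p := Cmod_ge_0 (z' - z)).
    specialize (Hd ltac:(lra)).
    replace (G z' - G z)%C with ((G z' - G z - c * (z' - z)) + c * (z' - z))%C by ring.
    eapply Rle_trans; [apply Cmod_triangle|]. rewrite Cmod_mult.
    apply (Rmult_lt_compat_l (1 + Cmod c)) in h2; [|lra].
    replace ((1 + Cmod c) * (eps / (1 + Cmod c))) with eps in h2 by (field; lra). lra.
Qed.

Lemma Ccontinuous_mult (f g : R -> C) :
  Ccontinuous f -> Ccontinuous g -> Ccontinuous (fun t => (f t * g t)%C).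
Proof.
  intros [f1 f2] [g1 g2]. split.
  - exact (continuity_minus _ _ (continuity_mult _ _ f1 g1) (continuity_mult _ _ f2 g2)).
  - exact (continuity_plus _ _ (continuity_mult _ _ f1 g2) (continuity_mult _ _ f2 g1)).
Qed.

Lemma Ccontinuous_plus (f g : R -> C) :
  Ccontinuous f -> Ccontinuous g -> Ccontinuous (fun t => (f t + g t)%C).
Proof.
  intros [f1 f2] [g1 g2]. split.
  - exact (continuity_plus _ _ f1 g1).
  - exact (continuity_plus _ _ f2 g2).
Qed.

Lemma Ccontinuous_const (c : C) : Ccontinuous (fun _ => c).
Proof. split; apply continuity_const; now intros x y. Qed.

Lemma Ccontinuous_pow (f : R -> C) (n : nat) :
  Ccontinuous f -> Ccontinuous (fun t => (f t ^ n)%C).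
Proof.
  intros hf. induction n as [|n IH]; simpl.
  - apply Ccontinuous_const.
  - now apply Ccontinuous_mult.
Qed.

Lemma Ccontinuous_inv (f : R -> C) :
  (forall t, f t <> 0) -> Ccontinuous f -> Ccontinuous (fun t => (/ f t)%C).
Proof.
  intros nz [f1 f2].
  assert (nn : forall t, fst (f t) ^ 2 + snd (f t) ^ 2 <> 0).
  { intros t E. apply (nz t). apply Cmod_eq_0. unfold Cmod. now rewrite E, sqrt_0. }
  assert (D : continuity (fun t => fst (f t) ^ 2 + snd (f t) ^ 2)).
  { replace (fun t => fst (f t) ^ 2 + snd (f t) ^ 2) with
      (fun t => fst (f t) * fst (f t) + snd (f t) * snd (f t))
      by (apply functional_extensionality; intros; ring).
    exact (continuity_plus _ _ (continuity_mult _ _ f1 f1) (continuity_mult _ _ f2 f2)). }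
  split.
  - exact (continuity_div _ _ f1 D nn).
  - exact (continuity_div _ _ (continuity_opp _ f2) D nn).
Qed.

(** Integration against dt, that is, dz / (i z) on the circle. The factor 1 / (2 PI) is left out and
    divided by when the Taylor coefficients are formed. *)
Definition CInt (f : R -> C) : C :=
  (RInt (fun t => fst (f t)) 0 (2 * PI), RInt (fun t => snd (f t)) 0 (2 * PI)).

Lemma two_PI_pos : 0 <= 2 * PI.
Proof. assert (h := PI_RGT_0). lra. Qed.

Lemma ex_RInt_continuity (f : R -> R) (a b : R) : continuity f -> ex_RInt f a b.
Proof.
  intros h. apply (ex_RInt_continuous (V := R_CompleteNormedModule)).
  intros z _. apply continuity_pt_filterlim, h.
Qed.

Lemma CInt_plus (f g : R -> C) :
  Ccontinuous f -> Ccontinuous g ->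
  CInt (fun t => (f t + g t)%C) = (CInt f + CInt g)%C.
Proof.
  intros [f1 f2] [g1 g2]. unfold CInt, Cplus; simpl. f_equal;
  apply (RInt_plus (V := R_CompleteNormedModule)); now apply ex_RInt_continuity.
Qed.

Lemma CInt_scal (c : C) (f : R -> C) :
  Ccontinuous f -> CInt (fun t => (c * f t)%C) = (c * CInt f)%C.
Proof.
  intros [f1 f2]. destruct c as [x y]. unfold CInt, Cmult; simpl.
  assert (e1 := ex_RInt_continuity _ 0 (2 * PI) f1).
  assert (e2 := ex_RInt_continuity _ 0 (2 * PI) f2).
  assert (s : forall k g, ex_RInt g 0 (2 * PI) -> ex_RInt (fun t => k * g t) 0 (2 * PI))
    by (intros; now apply (ex_RInt_scal (V := R_NormedModule))).
  assert (S : forall k g, ex_RInt g 0 (2 * PI) ->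
    RInt (fun t => k * g t) 0 (2 * PI) = k * RInt g 0 (2 * PI))
    by (intros; now apply (RInt_scal (V := R_CompleteNormedModule))).
  f_equal.
  - etransitivity; [apply (RInt_minus (V := R_CompleteNormedModule)); now apply s|].
    now rewrite !S.
  - etransitivity; [apply (RInt_plus (V := R_CompleteNormedModule)); now apply s|].
    now rewrite !S.
Qed.

(** The two components are bounded separately, which gives 4 PI in place of the sharp 2 PI; the loss
    only affects constants. *)
Lemma CInt_bound (f : R -> C) (M : R) :
  Ccontinuous f -> (forall t, Cmod (f t) <= M) -> Cmod (CInt f) <= 4 * PI * M.
Proof.
  intros [f1 f2] H. assert (hpi := two_PI_pos).
  eapply Rle_trans; [apply Cmod_le_abs|]. simpl.
  assert (B1 : Rabs (RInt (fun t => fst (f t)) 0 (2 * PI)) <= (2 * PI - 0) * M).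
  { apply abs_RInt_le_const; auto; [now apply ex_RInt_continuity|].
    intros. eapply Rle_trans; [apply abs_fst_le_Cmod | apply H]. }
  assert (B2 : Rabs (RInt (fun t => snd (f t)) 0 (2 * PI)) <= (2 * PI - 0) * M).
  { apply abs_RInt_le_const; auto; [now apply ex_RInt_continuity|].
    intros. eapply Rle_trans; [apply abs_snd_le_Cmod | apply H]. }
  lra.
Qed.

Definition expi' (t : R) : C := (cos t, - sin t).

Lemma Ccontinuous_expi' : Ccontinuous expi'.
Proof.
  split; [exact continuity_cos | exact (continuity_opp _ continuity_sin)].
Qed.

Lemma expi_expi' (t : R) : (expi t * expi' t)%C = 1.
Proof.
  unfold expi, expi', Cmult, RtoC; simpl. assert (h := sin2_cos2 t). unfold Rsqr in h.
  f_equal; nra.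
Qed.

Lemma Cmod_cos_sin (x y : R) : x * x + y * y = 1 -> Cmod (x, y) = 1.
Proof.
  intros h. unfold Cmod; simpl. rewrite !Rmult_1_r, h. apply sqrt_1.
Qed.

Lemma Cmod_expi (t : R) : Cmod (expi t) = 1.
Proof. apply Cmod_cos_sin. assert (h := sin2_cos2 t). unfold Rsqr in h. lra. Qed.

Lemma Cmod_expi' (t : R) : Cmod (expi' t) = 1.
Proof. apply Cmod_cos_sin. assert (h := sin2_cos2 t). unfold Rsqr in h. lra. Qed.

Lemma expi'_pow (t : R) (n : nat) :
  (expi' t ^ n)%C = (cos (INR n * t), - sin (INR n * t)).
Proof.
  induction n as [|n IH].
  - simpl. rewrite Rmult_0_l, cos_0, sin_0, Ropp_0. reflexivity.
  - rewrite S_INR, Rmult_plus_distr_r, Rmult_1_l, cos_plus, sin_plus, Cpow_S, IH.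
    unfold expi', Cmult; simpl. f_equal; ring.
Qed.

Lemma CInt_expi'_pow (n : nat) :
  CInt (fun t => (expi' t ^ n)%C) = match n with O => RtoC (2 * PI) | _ => 0 end.
Proof.
  replace (fun t => (expi' t ^ n)%C) with
    (fun t => (cos (INR n * t), - sin (INR n * t)) : C)
    by (apply functional_extensionality; intros; symmetry; apply expi'_pow).
  unfold CInt; simpl. destruct n as [|n].
  - simpl. unfold RtoC. f_equal.
    + rewrite (RInt_ext _ (fun _ => 1)) by (intros; now rewrite Rmult_0_l, cos_0).
      rewrite RInt_const. unfold scal; simpl; unfold mult; simpl. ring.
    + rewrite (RInt_ext _ (fun _ => 0))
        by (intros; now rewrite Rmult_0_l, sin_0, Ropp_0).
      rewrite RInt_const. unfold scal; simpl; unfold mult; simpl. ring.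
  - set (N := INR (S n)). assert (hN : N <> 0) by (apply not_0_INR; lia).
    assert (per : cos (N * (2 * PI)) = 1 /\ sin (N * (2 * PI)) = 0).
    { replace (N * (2 * PI)) with (0 + 2 * N * PI) by ring.
      unfold N. rewrite cos_period, sin_period. split; [apply cos_0 | apply sin_0]. }
    destruct per as [pc ps]. unfold RtoC. f_equal.
    + apply is_RInt_unique.
      replace 0 with (minus (sin (N * (2 * PI)) / N) (sin (N * 0) / N)) at 2.
      * apply (is_RInt_derive (V := R_CompleteNormedModule) (fun t => sin (N * t) / N)).
        -- intros. auto_derive; auto. field. auto.
        -- intros. apply continuity_pt_filterlim.
           apply derivable_continuous_pt. reg.
      * rewrite ps, Rmult_0_r, sin_0. unfold minus, plus, opp; simpl. field. auto.
    + apply is_RInt_unique.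
      replace 0 with (minus (cos (N * (2 * PI)) / N) (cos (N * 0) / N)) at 2.
      * apply (is_RInt_derive (V := R_CompleteNormedModule) (fun t => cos (N * t) / N)).
        -- intros. auto_derive; auto. field. auto.
        -- intros. apply continuity_pt_filterlim.
           apply derivable_continuous_pt. reg.
      * rewrite pc, Rmult_0_r, cos_0. unfold minus, plus, opp; simpl. field. auto.
Qed.

(** * Cauchy's formula on the unit disk *)

Definition segment (w : C) (l t : R) : C := (w + RtoC l * (expi t - w))%C.
(** Equal to e^{it} / (e^{it} - w), so that on the circle G k dt is the Cauchy form G dz / (i (z -
    w)). Written with e^{-it}, it is the sum of the geometric series in w e^{-it}. *)
Definition cauchy_kernel (w : C) (t : R) : C := (/ (1 - w * expi' t))%C.

Lemma Cmod_ge_sub (x y : C) : Cmod x - Cmod y <= Cmod (x - y).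
Proof.
  assert (h := Cmod_triangle (x - y) y).
  replace (x - y + y)%C with x in h by ring. lra.
Qed.

Lemma Cmod_minus (x y : C) : Cmod (x - y) <= Cmod x + Cmod y.
Proof.
  eapply Rle_trans; [apply Cmod_triangle|]. rewrite Cmod_opp. lra.
Qed.

Section Kernel.
Variable w : C.
Hypothesis hw : Cmod w < 1.

Lemma Cmod_kernel_denominator (t : R) : 1 - Cmod w <= Cmod (1 - w * expi' t).
Proof.
  eapply Rle_trans; [|apply Cmod_ge_sub].
  rewrite Cmod_mult, Cmod_expi', Cmod_1. lra.
Qed.

Lemma kernel_denominator_neq0 (t : R) : (1 - w * expi' t)%C <> 0.
Proof.
  intros E. assert (h := Cmod_kernel_denominator t). rewrite E, Cmod_0 in h. lra.
Qed.

Lemma Cmod_kernel (t : R) : Cmod (cauchy_kernel w t) <= / (1 - Cmod w).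
Proof.
  unfold cauchy_kernel. rewrite Cmod_inv by apply kernel_denominator_neq0.
  apply Rinv_le_contravar; [lra | apply Cmod_kernel_denominator].
Qed.

Lemma Ccontinuous_geometric_factor : Ccontinuous (fun t => w * expi' t)%C.
Proof.
  apply Ccontinuous_mult; [apply Ccontinuous_const | apply Ccontinuous_expi'].
Qed.

Lemma Ccontinuous_kernel : Ccontinuous (cauchy_kernel w).
Proof.
  apply (Ccontinuous_inv (fun t => 1 - w * expi' t)%C); [apply kernel_denominator_neq0|].
  replace (fun t => 1 - w * expi' t)%C with (fun t => 1 + (- (1)) * (w * expi' t))%C
    by (apply functional_extensionality; intros; ring).
  apply Ccontinuous_plus; [apply Ccontinuous_const|].
  apply Ccontinuous_mult; [apply Ccontinuous_const | apply Ccontinuous_geometric_factor].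
Qed.

(** This identity is behind the closedness below: the derivative of [segment] in l is e^{it} - w and
    in t it is i l e^{it}, so k times the former equals the latter divided by i l. *)
Lemma kernel_radius (t : R) : ((expi t - w) * cauchy_kernel w t)%C = expi t.
Proof.
  unfold cauchy_kernel.
  replace (expi t - w)%C with (expi t * (1 - w * expi' t))%C.
  - field. apply kernel_denominator_neq0.
  - transitivity (expi t - w * (expi t * expi' t))%C; [ring|].
    rewrite expi_expi'. ring.
Qed.

(** Makes the dt coefficient G k totally differentiable, as Goursat's argument requires; closedness
    itself involves the derivative of G k in l, where k is constant. *)
Lemma kernel_derivable (t : R) :
  exists d1 d2, derivable_pt_lim (fun t => fst (cauchy_kernel w t)) t d1 /\
                derivable_pt_lim (fun t => snd (cauchy_kernel w t)) t d2.
Proof.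
  assert (nz : forall t, fst (1 - w * expi' t)%C ^ 2 + snd (1 - w * expi' t)%C ^ 2 <> 0).
  { intros s E. apply (kernel_denominator_neq0 s). apply Cmod_eq_0.
    unfold Cmod. now rewrite E, sqrt_0. }
  specialize (nz t). destruct w as [w1 w2].
  unfold cauchy_kernel, Cinv, expi' in *. simpl in *.
  assert (e1 : ex_derive (fun t => (1 + - (w1 * cos t - w2 * - sin t)) /
    ((1 + - (w1 * cos t - w2 * - sin t)) * ((1 + - (w1 * cos t - w2 * - sin t)) * 1) +
     (0 + - (w1 * - sin t + w2 * cos t)) * ((0 + - (w1 * - sin t + w2 * cos t)) * 1))) t)
    by (auto_derive; exact nz).
  assert (e2 : ex_derive (fun t => - (0 + - (w1 * - sin t + w2 * cos t)) /
    ((1 + - (w1 * cos t - w2 * - sin t)) * ((1 + - (w1 * cos t - w2 * - sin t)) * 1) +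
     (0 + - (w1 * - sin t + w2 * cos t)) * ((0 + - (w1 * - sin t + w2 * cos t)) * 1))) t)
    by (auto_derive; exact nz).
  destruct e1 as [d1 h1]. destruct e2 as [d2 h2].
  exists d1, d2. split; now apply is_derive_Reals.
Qed.

Lemma Cmod_segment (l t : R) : 0 <= l <= 1 -> Cmod (segment w l t) <= 1.
Proof.
  intros hl. unfold segment.
  replace (w + RtoC l * (expi t - w))%C with (RtoC (1 - l) * w + RtoC l * expi t)%C
    by (rewrite RtoC_minus; ring).
  eapply Rle_trans; [apply Cmod_triangle|].
  rewrite !Cmod_mult, !Cmod_R, Cmod_expi, !Rabs_pos_eq by lra. nra.
Qed.

Section Homotopy.
Variable G : C -> C.
Hypothesis hG : forall z, Cmod z <= 1 -> hol_at G z.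

(** Chain rule: with c1 + i c2 the derivative of G at the point, the four partials are the
    components of (c1 + i c2)(e^{it} - w) and of (c1 + i c2) i l e^{it}. *)
Lemma segment_differentiable (l t : R) : 0 <= l <= 1 ->
  exists c1 c2,
    differentiable_pt_lim (fun u v => fst (G (segment w u v))) l t
      (c1 * (cos t - fst w) - c2 * (sin t - snd w)) (l * (- c1 * sin t - c2 * cos t)) /\
    differentiable_pt_lim (fun u v => snd (G (segment w u v))) l t
      (c2 * (cos t - fst w) + c1 * (sin t - snd w)) (l * (- c2 * sin t + c1 * cos t)).
Proof.
  intros hl.
  assert (hX : differentiable_pt_lim (fun u v => fst (segment w u v)) l t
    (cos t - fst w) (- l * sin t)).
  { eapply (differentiable_pt_lim_ext (fun u v => fst w + u * (cos v - fst w))).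
    - exists (mkposreal 1 Rlt_0_1). intros u v _ _. simpl. ring.
    - replace (cos t - fst w) with (0 + ((cos t - fst w) * 1 + l * 0)) at 1 by ring.
      replace (- l * sin t) with (0 + ((cos t - fst w) * 0 + l * (- sin t - 0))) by ring.
      apply (differentiable_pt_lim_plus (fun _ _ => fst w) (fun u v => u * (cos v - fst w))).
      + apply (differentiable_pt_lim_proj1_0 (fun _ => fst w)), derivable_pt_lim_const.
      + apply (differentiable_pt_lim_mult (fun u _ => u) (fun _ v => cos v - fst w)).
        * apply (differentiable_pt_lim_proj1_0 (fun u => u)), derivable_pt_lim_id.
        * apply (differentiable_pt_lim_proj2_0 (fun v => cos v - fst w)).
          apply derivable_pt_lim_minus; [apply derivable_pt_lim_cos | apply derivable_pt_lim_const]. }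
  assert (hY : differentiable_pt_lim (fun u v => snd (segment w u v)) l t
    (sin t - snd w) (l * cos t)).
  { eapply (differentiable_pt_lim_ext (fun u v => snd w + u * (sin v - snd w))).
    - exists (mkposreal 1 Rlt_0_1). intros u v _ _. simpl. ring.
    - replace (sin t - snd w) with (0 + ((sin t - snd w) * 1 + l * 0)) at 1 by ring.
      replace (l * cos t) with (0 + ((sin t - snd w) * 0 + l * (cos t - 0))) by ring.
      apply (differentiable_pt_lim_plus (fun _ _ => snd w) (fun u v => u * (sin v - snd w))).
      + apply (differentiable_pt_lim_proj1_0 (fun _ => snd w)), derivable_pt_lim_const.
      + apply (differentiable_pt_lim_mult (fun u _ => u) (fun _ v => sin v - snd w)).
        * apply (differentiable_pt_lim_proj1_0 (fun u => u)), derivable_pt_lim_id.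
        * apply (differentiable_pt_lim_proj2_0 (fun v => sin v - snd w)).
          apply derivable_pt_lim_minus; [apply derivable_pt_lim_sin | apply derivable_pt_lim_const]. }
  assert (h := hG _ (Cmod_segment l t hl)).
  rewrite (surjective_pairing (segment w l t)) in h.
  apply hol_at_differentiable in h. destruct h as (c1 & c2 & hU & hV).
  exists c1, c2. split.
  - eapply (differentiable_pt_lim_ext
      (fun u v => fst (G (fst (segment w u v), snd (segment w u v))))).
    { exists (mkposreal 1 Rlt_0_1). intros u v _ _. now rewrite <- surjective_pairing. }
    replace (c1 * (cos t - fst w) - c2 * (sin t - snd w)) with
      (c1 * (cos t - fst w) + - c2 * (sin t - snd w)) by ring.
    replace (l * (- c1 * sin t - c2 * cos t)) with
      (c1 * (- l * sin t) + - c2 * (l * cos t)) by ring.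
    now apply (differentiable_pt_lim_comp (fun x y => fst (G (x, y)))
      (fun u v => fst (segment w u v)) (fun u v => snd (segment w u v))).
  - eapply (differentiable_pt_lim_ext
      (fun u v => snd (G (fst (segment w u v), snd (segment w u v))))).
    { exists (mkposreal 1 Rlt_0_1). intros u v _ _. now rewrite <- surjective_pairing. }
    replace (l * (- c2 * sin t + c1 * cos t)) with
      (c2 * (- l * sin t) + c1 * (l * cos t)) by ring.
    now apply (differentiable_pt_lim_comp (fun x y => snd (G (x, y)))
      (fun u v => fst (segment w u v)) (fun u v => snd (segment w u v))).
Qed.

Lemma Ccontinuous_segment (l : R) :
  0 <= l <= 1 -> Ccontinuous (fun t => G (segment w l t)).
Proof.
  intros hl. split; intros t;
    destruct (segment_differentiable l t hl) as (c1 & c2 & hU & hV);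
    apply continuity_pt_filterlim.
  - exact (proj2 (differentiable_pt_lim_sections _ _ _ _ _ hU)).
  - exact (proj2 (differentiable_pt_lim_sections _ _ _ _ _ hV)).
Qed.

Lemma segment_period (l : R) : segment w l (2 * PI) = segment w l 0.
Proof.
  unfold segment, expi. now rewrite cos_2PI, sin_2PI, cos_0, sin_0.
Qed.

Lemma inv_first_differentiable (l t : R) :
  0 < l -> differentiable_pt_lim (fun u _ => / u) l t (- / l ^ 2) 0.
Proof.
  intros hl. apply (differentiable_pt_lim_proj1_0 Rinv).
  apply is_derive_Reals. auto_derive; [lra|]. field. lra.
Qed.

(* In the coordinates (l, t) of [segment w], the form G(z) dz / (i (z - w)) is
   G (dl / (i l) + k dt), where k is the Cauchy kernel. *)
Lemma kernel_integral_homotopy (l0 : R) : 0 < l0 <= 1 ->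
  CInt (fun t => G (segment w 1 t) * cauchy_kernel w t)%C
  = CInt (fun t => G (segment w l0 t) * cauchy_kernel w t)%C.
Proof.
  intros hl0.
  set (U := fun l t => fst (G (segment w l t))).
  set (V := fun l t => snd (G (segment w l t))).
  set (k1 := fun t => fst (cauchy_kernel w t)).
  set (k2 := fun t => snd (cauchy_kernel w t)).
  assert (rad : forall t, (cos t - fst w) * k1 t - (sin t - snd w) * k2 t = cos t /\
                          (cos t - fst w) * k2 t + (sin t - snd w) * k1 t = sin t).
  { intros t. assert (E := kernel_radius t).
    assert (E1 := f_equal fst E). assert (E2 := f_equal snd E).
    unfold Cmult, Cminus, Cplus, Copp, expi in E1, E2. cbn [fst snd] in E1, E2.
    fold (k1 t) (k2 t) in E1, E2. split; (etransitivity; [|first [exact E1 | exact E2]]; ring). }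
  (* Real part of the form: 1 / i = -i turns G / (i l) into (V - i U) / l. The imaginary part is
     [Z2]. *)
  assert (Z1 : boundary_integral (fun l t => / l * V l t)
    (fun l t => U l t * k1 t + - (V l t * k2 t)) l0 1 0 (2 * PI) = 0).
  { apply boundary_integral_closed; [|lra|apply two_PI_pos].
    intros l t hl ht.
    destruct (segment_differentiable l t ltac:(lra)) as (c1 & c2 & hU & hV).
    destruct (kernel_derivable t) as (d1 & d2 & hk1 & hk2).
    apply (differentiable_pt_lim_proj2_0 _ l) in hk1.
    apply (differentiable_pt_lim_proj2_0 _ l) in hk2.
    assert (hP := differentiable_pt_lim_mult _ _ _ _ _ _ _ _
      (inv_first_differentiable l t ltac:(lra)) hV).
    assert (hQ := differentiable_pt_lim_plus _ _ _ _ _ _ _ _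
      (differentiable_pt_lim_mult _ _ _ _ _ _ _ _ hU hk1)
      (differentiable_pt_lim_opp _ _ _ _ _
        (differentiable_pt_lim_mult _ _ _ _ _ _ _ _ hV hk2))).
    cbv beta in hP, hQ. destruct (rad t) as [r1 r2].
    do 3 eexists. split; [exact hP|].
    match type of hQ with differentiable_pt_lim _ _ _ ?a _ =>
      match goal with |- differentiable_pt_lim _ _ _ ?b _ =>
        replace b with a; [exact hQ|] end end.
    fold (k1 t) (k2 t).
    transitivity (c1 * ((cos t - fst w) * k1 t - (sin t - snd w) * k2 t)
      - c2 * ((cos t - fst w) * k2 t + (sin t - snd w) * k1 t)); [ring|].
    rewrite r1, r2. field. lra. }
  assert (Z2 : boundary_integral (fun l t => / l * - U l t)
    (fun l t => U l t * k2 t + V l t * k1 t) l0 1 0 (2 * PI) = 0).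
  { apply boundary_integral_closed; [|lra|apply two_PI_pos].
    intros l t hl ht.
    destruct (segment_differentiable l t ltac:(lra)) as (c1 & c2 & hU & hV).
    destruct (kernel_derivable t) as (d1 & d2 & hk1 & hk2).
    apply (differentiable_pt_lim_proj2_0 _ l) in hk1.
    apply (differentiable_pt_lim_proj2_0 _ l) in hk2.
    assert (hP := differentiable_pt_lim_mult _ _ _ _ _ _ _ _
      (inv_first_differentiable l t ltac:(lra)) (differentiable_pt_lim_opp _ _ _ _ _ hU)).
    assert (hQ := differentiable_pt_lim_plus _ _ _ _ _ _ _ _
      (differentiable_pt_lim_mult _ _ _ _ _ _ _ _ hU hk2)
      (differentiable_pt_lim_mult _ _ _ _ _ _ _ _ hV hk1)).
    cbv beta in hP, hQ. destruct (rad t) as [r1 r2].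
    do 3 eexists. split; [exact hP|].
    match type of hQ with differentiable_pt_lim _ _ _ ?a _ =>
      match goal with |- differentiable_pt_lim _ _ _ ?b _ =>
        replace b with a; [exact hQ|] end end.
    fold (k1 t) (k2 t).
    transitivity (c1 * ((cos t - fst w) * k2 t + (sin t - snd w) * k1 t)
      + c2 * ((cos t - fst w) * k1 t - (sin t - snd w) * k2 t)); [ring|].
    rewrite r1, r2. field. lra. }
  unfold boundary_integral, U, V in Z1, Z2.
  (* The sides t = 0 and t = 2 PI have equal integrands and cancel, which leaves the integrals along
     l = 1 and l = l0. *)
  rewrite (RInt_ext (fun x => / x * snd (G (segment w x (2 * PI))))
    (fun x => / x * snd (G (segment w x 0)))) in Z1
    by (intros; now rewrite segment_period).
  rewrite (RInt_ext (fun x => / x * - fst (G (segment w x (2 * PI))))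
    (fun x => / x * - fst (G (segment w x 0)))) in Z2
    by (intros; now rewrite segment_period).
  unfold CInt, Cmult. cbn [fst snd]. unfold Rminus. f_equal.
  - unfold k1, k2 in Z1. lra.
  - unfold k1, k2 in Z2. lra.
Qed.

(** As l0 tends to 0 the contour shrinks to w and, by continuity, G may be replaced by G w under the
    integral. The integral of the kernel is left unevaluated here; it follows later from the
    geometric series. *)
Lemma cauchy_formula :
  CInt (fun t => G (expi t) * cauchy_kernel w t)%C = (G w * CInt (cauchy_kernel w))%C.
Proof.
  assert (Ck := Ccontinuous_kernel).
  assert (hz : Cmod (CInt (fun t => G (expi t) * cauchy_kernel w t)
    - G w * CInt (cauchy_kernel w))%C <= 0).
  2:{ assert (p := Cmod_ge_0 (CInt (fun t => G (expi t) * cauchy_kernel w t)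
        - G w * CInt (cauchy_kernel w))%C).
      assert (E := Cmod_eq_0 _ (Rle_antisym _ _ hz p)).
      match goal with |- ?a = ?b => replace a with (a - b + b)%C by ring; rewrite E end.
      ring. }
  apply le_epsilon. intros eps heps. rewrite Rplus_0_l.
  set (K := / (1 - Cmod w)). assert (hK : 0 < K) by (apply Rinv_0_lt_compat; lra).
  assert (hpi := PI_RGT_0).
  set (e' := eps / (4 * PI * K)).
  assert (he' : 0 < e') by (apply Rdiv_lt_0_compat; [lra|]; apply Rmult_lt_0_compat; lra).
  destruct (hol_at_continuous G w (hG w ltac:(lra)) e' he') as [d [hd Hd]].
  (* Since |e^{it} - w| <= 1 + |w| < 2, the bound l0 <= d / 3 keeps the whole contour within d of
     w. *)
  set (l0 := Rmin 1 (d / 3)).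
  assert (hl1 : l0 <= 1) by apply Rmin_l.
  assert (hl2 : l0 <= d / 3) by apply Rmin_r.
  assert (hl0 : 0 < l0) by (apply Rmin_pos; lra).
  replace (fun t => G (expi t) * cauchy_kernel w t)%C
    with (fun t => G (segment w 1 t) * cauchy_kernel w t)%C.
  2:{ apply functional_extensionality. intros t. do 2 f_equal. unfold segment. ring. }
  rewrite (kernel_integral_homotopy l0) by lra.
  assert (CG := Ccontinuous_segment l0 ltac:(lra)).
  replace (CInt (fun t => G (segment w l0 t) * cauchy_kernel w t)
    - G w * CInt (cauchy_kernel w))%C with
    (CInt (fun t => G (segment w l0 t) * cauchy_kernel w t
      + - G w * cauchy_kernel w t)%C).
  2:{ rewrite CInt_plus, CInt_scal; auto.
      - ring.
      - now apply Ccontinuous_mult.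
      - apply Ccontinuous_mult; [apply Ccontinuous_const | exact Ck]. }
  eapply Rle_trans; [apply (CInt_bound _ (e' * K))|].
  - apply Ccontinuous_plus; apply Ccontinuous_mult; auto. apply Ccontinuous_const.
  - intros t.
    replace (G (segment w l0 t) * cauchy_kernel w t + - G w * cauchy_kernel w t)%C
      with ((G (segment w l0 t) - G w) * cauchy_kernel w t)%C by ring.
    rewrite Cmod_mult. apply Rmult_le_compat; try apply Cmod_ge_0; [|apply Cmod_kernel].
    apply Hd. unfold segment.
    replace (w + RtoC l0 * (expi t - w) - w)%C with (RtoC l0 * (expi t - w))%C by ring.
    rewrite Cmod_mult, Cmod_R, Rabs_pos_eq by lra.
    assert (b := Cmod_minus (expi t) w). rewrite Cmod_expi in b. nra.
  - unfold e'. right. field. lra.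
Qed.
End Homotopy.

(** * Geometric expansion of the Cauchy kernel *)

Fixpoint csum (f : nat -> C) (n : nat) : C :=
  match n with O => 0 | S n => (csum f n + f n)%C end.

(** The finite geometric identity 1 / (1 - q) = 1 + ... + q^(N-1) + q^N / (1 - q) with q = w
    e^{-it}, integrated against H. Working with finite sums avoids exchanging a limit with the
    integral. *)
Lemma kernel_telescope (H : R -> C) (N : nat) : Ccontinuous H ->
  CInt (fun t => H t * cauchy_kernel w t)%C =
  (csum (fun n => w ^ n * CInt (fun t => H t * expi' t ^ n)) N
   + CInt (fun t => H t * ((w * expi' t) ^ N * cauchy_kernel w t)))%C.
Proof.
  intros hH. assert (Ck := Ccontinuous_kernel).
  assert (Cq := Ccontinuous_geometric_factor).
  assert (Ce := Ccontinuous_expi').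
  induction N as [|N IH].
  - simpl. replace (fun t => H t * (1 * cauchy_kernel w t))%C
      with (fun t => H t * cauchy_kernel w t)%C
      by (apply functional_extensionality; intros; ring). ring.
  - rewrite IH. cbn [csum]. rewrite <- Cplus_assoc. f_equal.
    rewrite <- CInt_scal, <- CInt_plus.
    + f_equal. apply functional_extensionality. intros t.
      rewrite Cpow_S, Cpow_mult_l. unfold cauchy_kernel. field.
      apply kernel_denominator_neq0.
    + apply Ccontinuous_mult; [apply Ccontinuous_const|].
      apply Ccontinuous_mult; [exact hH | now apply Ccontinuous_pow].
    + apply Ccontinuous_mult; [exact hH|].
      apply Ccontinuous_mult; [now apply Ccontinuous_pow | exact Ck].
    + apply Ccontinuous_mult; [exact hH | now apply Ccontinuous_pow].
Qed.

Lemma kernel_remainder (H : R -> C) (B : R) (N : nat) : Ccontinuous H ->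
  (forall t, Cmod (H t) <= B) ->
  Cmod (CInt (fun t => H t * ((w * expi' t) ^ N * cauchy_kernel w t))%C)
    <= 4 * PI * (B * (Cmod w ^ N * / (1 - Cmod w))).
Proof.
  intros hH hB.
  apply CInt_bound.
  - apply Ccontinuous_mult; [exact hH|].
    apply Ccontinuous_mult; [apply Ccontinuous_pow, Ccontinuous_geometric_factor
                            | apply Ccontinuous_kernel].
  - intros t. rewrite !Cmod_mult, Cmod_pow, Cmod_mult, Cmod_expi', Rmult_1_r.
    assert (p := Cmod_kernel t).
    apply Rmult_le_compat; try apply Cmod_ge_0; auto.
    + apply Rmult_le_pos; [apply pow_le, Cmod_ge_0 | apply Cmod_ge_0].
    + apply Rmult_le_compat_l; [apply pow_le, Cmod_ge_0 | exact p].
Qed.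

(** Telescoping with H = 1: only the term n = 0 has a nonzero integral, and the remainder tends to 0
    because |w| < 1. The order [S N] ensures that this term is in the sum. *)
Lemma CInt_kernel : CInt (cauchy_kernel w) = RtoC (2 * PI).
Proof.
  set (D := Cmod (CInt (cauchy_kernel w) - RtoC (2 * PI))).
  assert (hpi := PI_RGT_0).
  set (K := 4 * PI * / (1 - Cmod w)).
  assert (hK : 0 < K) by (apply Rmult_lt_0_compat; [lra | apply Rinv_0_lt_compat; lra]).
  assert (B : forall N, D <= K * Cmod w ^ S N).
  { intros N.
    assert (T := kernel_telescope (fun _ => 1) (S N) (Ccontinuous_const 1)).
    assert (R := kernel_remainder (fun _ => 1) 1 (S N) (Ccontinuous_const 1)
      ltac:(intros; cbv beta; rewrite Cmod_1; lra)).
    assert (S : forall N, csum (fun n => w ^ n * CInt (fun t => 1 * expi' t ^ n))%C (S N)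
      = RtoC (2 * PI)).
    { assert (E : forall n, CInt (fun t => 1 * expi' t ^ n)%C =
        match n with O => RtoC (2 * PI) | _ => 0 end).
      { intros n. rewrite <- (CInt_expi'_pow n). f_equal.
        apply functional_extensionality. intros; ring. }
      intros m; induction m as [|m IHm]; [cbn [csum]; rewrite (E O); simpl; ring|].
      change (csum ?f (S (S m))) with (csum f (S m) + f (S m))%C.
      rewrite IHm, (E (S m)). ring. }
    rewrite S in T. unfold D.
    replace (CInt (cauchy_kernel w)) with (CInt (fun t => 1 * cauchy_kernel w t)%C)
      by (f_equal; apply functional_extensionality; intros; ring).
    rewrite T.
    match goal with |- Cmod (?a + ?b - ?a) <= _ => replace (a + b - a)%C with b by ring end.
    eapply Rle_trans; [exact R|]. unfold K. right. ring. }
  assert (D0 : D = 0).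
  { assert (p : 0 <= D) by apply Cmod_ge_0.
    destruct (Req_dec D 0) as [E|NE]; [exact E|exfalso].
    destruct (pow_lt_1_zero (Cmod w)) with (y := D / K) as [n hn].
    { rewrite Rabs_pos_eq; [exact hw | apply Cmod_ge_0]. }
    { apply Rdiv_lt_0_compat; lra. }
    specialize (hn (S n) ltac:(lia)). specialize (B n).
    rewrite Rabs_pos_eq in hn by (apply pow_le, Cmod_ge_0).
    apply (Rmult_lt_compat_l K) in hn; [|exact hK].
    replace (K * (D / K)) with D in hn by (field; lra). lra. }
  apply Cmod_eq_0 in D0.
  replace (CInt (cauchy_kernel w)) with (CInt (cauchy_kernel w) - RtoC (2 * PI) + RtoC (2 * PI))%C
    by ring.
  rewrite D0. ring.
Qed.
End Kernel.

Lemma unit_circle_angle (z : C) : Cmod z = 1 -> exists t, - PI <= t <= PI /\ expi t = z.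
Proof.
  intros hz. destruct z as [x y].
  assert (e : x * x + y * y = 1).
  { assert (h : Cmod (x, y) ^ 2 = 1 ^ 2) by now rewrite hz.
    rewrite Cmod2_alt in h. simpl in h. lra. }
  assert (hx : -1 <= x <= 1) by (split; nra).
  assert (b := acos_bound x).
  assert (s : sin (acos x) = Rabs y).
  { rewrite sin_acos by exact hx. rewrite <- (sqrt_Rsqr_abs y). f_equal. unfold Rsqr. lra. }
  destruct (Rle_dec 0 y) as [hy|hy].
  - exists (acos x). split; [lra|]. unfold expi. rewrite cos_acos, s by exact hx.
    now rewrite Rabs_pos_eq.
  - exists (- acos x). split; [lra|]. unfold expi.
    rewrite cos_neg, sin_neg, cos_acos, s by exact hx.
    rewrite Rabs_left by lra. now rewrite Ropp_involutive.
Qed.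

Lemma continuous_on_circle_bounded (G : C -> C) :
  Ccontinuous (fun t => G (expi t)) -> exists B, 0 < B /\ forall t, Cmod (G (expi t)) <= B.
Proof.
  intros [h1 h2].
  assert (bd : forall f, continuity f -> exists B, forall t, - PI <= t <= PI -> Rabs (f t) <= B).
  { intros f hf. assert (hpi := PI_RGT_0).
    destruct (continuity_ab_maj (fun t => Rabs (f t)) (- PI) PI) as [x [hx _]]; [lra| |].
    - intros. apply (continuity_pt_comp f Rabs); [apply hf | apply Rcontinuity_abs].
    - now exists (Rabs (f x)). }
  destruct (bd _ h1) as [B1 H1]. destruct (bd _ h2) as [B2 H2].
  exists (Rmax 1 (B1 + B2)). split; [eapply Rlt_le_trans; [|apply Rmax_l]; lra|].
  intros t. destruct (unit_circle_angle (expi t) (Cmod_expi t)) as [s [hs <-]].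
  eapply Rle_trans; [apply Cmod_le_abs|]. eapply Rle_trans; [|apply Rmax_r].
  apply Rplus_le_compat; auto.
Qed.

(** The a n are the Fourier coefficients of G on the circle. Bounding integrals by 4 PI and dividing
    by 2 PI gives 2 B for the coefficients; in the remainder 1 / (1 - |w|) <= 2 doubles this, so 4 B
    covers both. *)
Lemma hol_disk_expansion (G : C -> C) :
  (forall z, Cmod z <= 1 -> hol_at G z) ->
  exists (B : R) (a : nat -> C), 0 < B /\ (forall n, Cmod (a n) <= B) /\
    forall w N, Cmod w <= / 2 ->
      Cmod (G w - csum (fun n => a n * w ^ n) N)%C <= B * Cmod w ^ N.
Proof.
  intros hG.
  assert (CG : Ccontinuous (fun t => G (expi t))).
  { replace (fun t => G (expi t)) with (fun t => G (segment 0 1 t)).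
    - apply Ccontinuous_segment; auto; [rewrite Cmod_0; lra | lra].
    - apply functional_extensionality; intros. f_equal. unfold segment. ring. }
  destruct (continuous_on_circle_bounded G CG) as [B [hB HB]].
  assert (hpi := PI_RGT_0).
  assert (pi2 : RtoC (2 * PI) <> 0) by (intros E; injection E; lra).
  assert (mpi : Cmod (RtoC (2 * PI)) = 2 * PI) by (rewrite Cmod_R, Rabs_pos_eq; lra).
  exists (4 * B), (fun n => CInt (fun t => G (expi t) * expi' t ^ n) / RtoC (2 * PI))%C.
  split; [lra|]. split.
  - intros n. rewrite Cmod_div, mpi by exact pi2.
    apply (Rmult_le_reg_r (2 * PI)); [lra|].
    unfold Rdiv. rewrite Rmult_assoc, Rinv_l, Rmult_1_r by lra.
    eapply Rle_trans; [apply (CInt_bound _ B)|nra].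
    + apply Ccontinuous_mult; [exact CG | apply Ccontinuous_pow, Ccontinuous_expi'].
    + intros t. rewrite Cmod_mult, Cmod_pow, Cmod_expi', pow1, Rmult_1_r. apply HB.
  - intros w N hw.
    assert (hw1 : Cmod w < 1) by lra.
    assert (F := cauchy_formula w hw1 G hG).
    rewrite (CInt_kernel w hw1), (kernel_telescope w hw1 _ N CG) in F.
    assert (R := kernel_remainder w hw1 _ B N CG HB).
    match type of R with Cmod ?r <= _ => set (rem := r) in * end.
    assert (S : csum (fun n => CInt (fun t => G (expi t) * expi' t ^ n)
        / RtoC (2 * PI) * w ^ n)%C N =
      (csum (fun n => w ^ n * CInt (fun t => G (expi t) * expi' t ^ n)) N / RtoC (2 * PI))%C).
    { clear F R rem. induction N as [|N IH]; simpl; [field; exact pi2|].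
      rewrite IH. field. exact pi2. }
    rewrite S.
    match type of F with (?s + _)%C = _ =>
      replace (G w - s / RtoC (2 * PI))%C with (rem / RtoC (2 * PI))%C end.
    2:{ transitivity ((G w * RtoC (2 * PI)) / RtoC (2 * PI)
          - csum (fun n => w ^ n * CInt (fun t => G (expi t) * expi' t ^ n)) N
            / RtoC (2 * PI))%C; [rewrite <- F|]; field; exact pi2. }
    rewrite Cmod_div, mpi by exact pi2.
    apply (Rmult_le_reg_r (2 * PI)); [lra|].
    unfold Rdiv. rewrite Rmult_assoc, Rinv_l, Rmult_1_r by lra.
    eapply Rle_trans; [exact R|].
    assert (iw : / (1 - Cmod w) <= 2).
    { rewrite <- (Rinv_inv 2). apply Rinv_le_contravar; lra. }
    assert (pw : 0 <= Cmod w ^ N) by (apply pow_le, Cmod_ge_0).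
    assert (q : Cmod w ^ N * / (1 - Cmod w) <= Cmod w ^ N * 2) by (apply Rmult_le_compat_l; auto).
    apply (Rmult_le_compat_l (4 * PI * B)) in q; [lra | apply Rmult_le_pos; lra].
Qed.

(** * Power series expansions and holomorphy *)

Lemma csum_ext (f g : nat -> C) (N : nat) :
  (forall n, (n < N)%nat -> f n = g n) -> csum f N = csum g N.
Proof.
  induction N as [|N IH]; intros H; [reflexivity|]. simpl.
  rewrite IH by (intros; apply H; lia). now rewrite H by lia.
Qed.

Lemma csum_minus (f g : nat -> C) (N : nat) :
  csum (fun n => f n - g n)%C N = (csum f N - csum g N)%C.
Proof. induction N as [|N IH]; simpl; [|rewrite IH]; ring. Qed.

Lemma csum_scal (c : C) (f : nat -> C) (N : nat) :
  csum (fun n => c * f n)%C N = (c * csum f N)%C.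
Proof. induction N as [|N IH]; simpl; [|rewrite IH]; ring. Qed.

Lemma Cnorm_Cmod (z : C) : Cnorm z = Cmod z.
Proof. unfold Cnorm, Cmod. f_equal. ring. Qed.

Definition expands (M : R) (z0 : C) (u : R -> C) (a : nat -> C) : Prop :=
  (forall n, Cmod (a n) <= M * M ^ n) /\
  forall t, Cmod (expi t - z0) < / (8 * M) -> forall N,
    Cmod (u t - csum (fun n => a n * (expi t - z0) ^ n) N)%C
      <= M * (M * Cmod (expi t - z0)) ^ N.

(** The disk of radius rho = r / 2, whose closure lies in D(z0, r), is rescaled to the unit disk.
    Any M above both B and 1 / rho absorbs the factors rho^(-n), and 1 / (8 M) <= rho / 8 keeps the
    arc inside the half-radius region where the expansion is valid. *)
Lemma holomorphic_expands (z0 : C) (r : R) (F : C -> C) (u : R -> C) :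
  0 < r -> holomorphic_on_disk z0 r F ->
  (forall t, in_disk z0 r (expi t) -> F (expi t) = u t) ->
  exists n a, expands (INR (S n)) z0 u a.
Proof.
  intros hr hF hu.
  set (rho := r / 2). assert (hrho : 0 < rho) by (unfold rho; lra).
  assert (nz : RtoC rho <> 0) by (intros E; injection E; lra).
  assert (mrho : Cmod (RtoC rho) = rho) by (rewrite Cmod_R, Rabs_pos_eq; lra).
  destruct (hol_disk_expansion (fun z => F (z0 + RtoC rho * z)%C)) as (B & a & hB & ha & hexp).
  { intros z hz.
    destruct (hF (z0 + RtoC rho * z)%C) as [c Hc].
    { unfold in_disk. rewrite Cnorm_Cmod. change Csub with Cminus.
      replace (z0 + RtoC rho * z - z0)%C with (RtoC rho * z)%C by ring.
      rewrite Cmod_mult, mrho. unfold rho in *. nra. }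
    exists (c * RtoC rho)%C. intros eps heps.
    destruct (Hc (eps / rho)) as [d [hd Hd]]; [now apply Rdiv_lt_0_compat|].
    exists (d / rho). split; [now apply Rdiv_lt_0_compat|].
    intros h hh. specialize (Hd (RtoC rho * h)%C).
    rewrite !Cnorm_Cmod in Hd. change Csub with Cminus in Hd. change Cadd with Cplus in Hd.
    change Cmul with Cmult in Hd. rewrite Cmod_mult, mrho in Hd.
    replace (z0 + RtoC rho * (z + h))%C with (z0 + RtoC rho * z + RtoC rho * h)%C by ring.
    replace (c * RtoC rho * h)%C with (c * (RtoC rho * h))%C by ring.
    eapply Rle_trans; [apply Hd|].
    - split; [apply Rmult_lt_0_compat; lra|].
      destruct hh as [_ hh]. apply (Rmult_lt_compat_l rho) in hh; [|lra].
      replace (rho * (d / rho)) with d in hh by (field; lra). exact hh.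
    - right. field. lra. }
  destruct (INR_unbounded (Rmax B (/ rho))) as [n hn].
  exists n, (fun n => a n / RtoC rho ^ n)%C.
  rewrite S_INR. set (M := INR n + 1).
  assert (ir : 0 < / rho) by now apply Rinv_0_lt_compat.
  assert (hM1 : B <= M).
  { assert (h := Rmax_l B (/ rho)). unfold M. lra. }
  assert (hM2 : / rho <= M).
  { assert (h := Rmax_r B (/ rho)). unfold M. lra. }
  assert (hM : 0 < M) by lra.
  split.
  - intros m. rewrite Cmod_div by now apply Cpow_nz.
    rewrite Cmod_pow, mrho. unfold Rdiv. rewrite <- pow_inv.
    apply Rmult_le_compat; [apply Cmod_ge_0 | apply pow_le; lra | |].
    + eapply Rle_trans; [apply ha | exact hM1].
    + apply pow_incr. lra.
  - intros t ht N.
    assert (h8 : / (8 * M) <= rho / 8).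
    { replace (rho / 8) with (/ (8 * / rho)) by (field; lra).
      apply Rinv_le_contravar; lra. }
    rewrite <- hu by (unfold in_disk; rewrite Cnorm_Cmod; change Csub with Cminus;
                      unfold rho in *; lra).
    set (z := (expi t - z0)%C) in *. assert (pz := Cmod_ge_0 z).
    specialize (hexp (z / RtoC rho)%C N).
    rewrite Cmod_div, mrho in hexp by exact nz.
    assert (ez : (z0 + RtoC rho * (z / RtoC rho))%C = expi t) by (unfold z; field; exact nz).
    rewrite ez in hexp.
    rewrite (csum_ext _ (fun n => a n / RtoC rho ^ n * z ^ n)%C) in hexp.
    2:{ intros m _. unfold Cdiv. rewrite Cpow_mult_l, Cpow_inv by exact nz. ring. }
    eapply Rle_trans; [apply hexp|].
    + apply (Rmult_le_reg_r rho); [exact hrho|]. unfold Rdiv.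
      rewrite Rmult_assoc, Rinv_l by lra. lra.
    + apply Rmult_le_compat; [lra| |exact hM1|].
      * apply pow_le. apply Rmult_le_pos; lra.
      * apply pow_incr. split; [apply Rmult_le_pos; lra|].
        unfold Rdiv. rewrite Rmult_comm. apply Rmult_le_compat_r; lra.
Qed.

(** * Sums of geometrically bounded series and their derivatives *)

Lemma C_complete (s : nat -> C) :
  (forall eps, 0 < eps -> exists N, forall n m, (N <= n)%nat -> (N <= m)%nat ->
    Cmod (s n - s m) <= eps) ->
  exists l, forall eps, 0 < eps -> exists N, forall n, (N <= n)%nat -> Cmod (s n - l) <= eps.
Proof.
  intros H.
  assert (K : forall p : C -> R, (forall z z', p (z - z')%C = p z - p z') ->
    (forall z, Rabs (p z) <= Cmod z) ->
    exists l, forall eps, 0 < eps -> exists N, forall n, (N <= n)%nat -> Rabs (p (s n) - l) <= eps).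
  { intros p hp1 hp2. destruct (Rcomplete.R_complete (fun n => p (s n))) as [l hl].
    - intros eps he. destruct (H (eps / 2)) as [N HN]; [lra|]. exists N.
      intros n m hn hm. unfold Rdist. rewrite <- hp1.
      eapply Rle_lt_trans; [apply hp2|].
      eapply Rle_lt_trans; [apply HN|]; auto with arith; lra.
    - exists l. intros eps he. destruct (hl eps he) as [N HN]. exists N.
      intros n hn. left. apply HN. exact hn. }
  destruct (K fst) as [l1 h1]; [reflexivity | apply abs_fst_le_Cmod|].
  destruct (K snd) as [l2 h2]; [reflexivity | apply abs_snd_le_Cmod|].
  exists (l1, l2). intros eps he.
  destruct (h1 (eps / 2)) as [N1 H1]; [lra|]. destruct (h2 (eps / 2)) as [N2 H2]; [lra|].
  exists (max N1 N2). intros n hn.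
  eapply Rle_trans; [apply Cmod_le_abs|].
  specialize (H1 n ltac:(lia)). specialize (H2 n ltac:(lia)).
  unfold Rminus in H1, H2. simpl. lra.
Qed.

Lemma geometric_arbitrarily_small (K eps : R) :
  0 < eps -> exists N, forall n, (N <= n)%nat -> K * (/ 2) ^ n <= eps.
Proof.
  intros he. set (K' := Rabs K + 1). assert (hK : 0 < K').
  { assert (h := Rabs_pos K). unfold K'. lra. }
  destruct (pow_lt_1_zero (/ 2)) with (y := eps / K') as [N HN].
  { rewrite Rabs_pos_eq; lra. }
  { now apply Rdiv_lt_0_compat. }
  exists N. intros n hn. specialize (HN n hn).
  assert (p : 0 < (/ 2) ^ n) by (apply pow_lt; lra).
  rewrite Rabs_pos_eq in HN by lra.
  apply (Rmult_lt_compat_l K') in HN; [|exact hK].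
  replace (K' * (eps / K')) with eps in HN by (field; lra).
  assert (k : K <= K') by (assert (h := Rle_abs K); unfold K'; lra). nra.
Qed.

Lemma le_geometric_le (x y K : R) : (forall n, x <= y + K * (/ 2) ^ n) -> x <= y.
Proof.
  intros H. apply le_epsilon. intros eps he.
  destruct (geometric_arbitrarily_small K eps he) as [N HN].
  specialize (HN N (le_n N)). specialize (H N). lra.
Qed.

(** The bound is the exact value of the geometric sum from n to n + m - 1; keeping the subtracted
    term is what lets the induction on m close. *)
Lemma csum_geometric_tail (f : nat -> C) (K : R) (n m : nat) :
  (forall k, Cmod (f k) <= K * (/ 2) ^ k) ->
  Cmod (csum f (n + m) - csum f n) <= 2 * K * (/ 2) ^ n - 2 * K * (/ 2) ^ (n + m).
Proof.
  intros H. induction m as [|m IH].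
  - rewrite Nat.add_0_r. replace (csum f n - csum f n)%C with (RtoC 0) by ring.
    rewrite Cmod_0. lra.
  - rewrite Nat.add_succ_r. simpl.
    replace (csum f (n + m) + f (n + m)%nat - csum f n)%C
      with ((csum f (n + m) - csum f n) + f (n + m)%nat)%C by ring.
    eapply Rle_trans; [apply Cmod_triangle|]. specialize (H (n + m)%nat). lra.
Qed.

Lemma geometric_series_converges (f : nat -> C) (K : R) :
  (forall k, Cmod (f k) <= K * (/ 2) ^ k) ->
  exists s, forall n, Cmod (s - csum f n) <= 2 * K * (/ 2) ^ n.
Proof.
  intros H.
  assert (hK : 0 <= K).
  { specialize (H O). simpl in H. assert (h := Cmod_ge_0 (f O)). lra. }
  assert (T : forall n m, (n <= m)%nat -> Cmod (csum f m - csum f n) <= 2 * K * (/ 2) ^ n).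
  { intros n m hnm. replace m with (n + (m - n))%nat by lia.
    eapply Rle_trans; [now apply (csum_geometric_tail f K)|].
    assert (0 <= (/ 2) ^ (n + (m - n))) by (apply pow_le; lra). nra. }
  destruct (C_complete (csum f)) as [s hs].
  - intros eps he. destruct (geometric_arbitrarily_small (4 * K) eps he) as [N HN].
    exists N. intros n m hn hm.
    replace (csum f n - csum f m)%C with ((csum f n - csum f N) - (csum f m - csum f N))%C by ring.
    eapply Rle_trans; [apply Cmod_minus|].
    assert (t1 := T N n hn). assert (t2 := T N m hm). specialize (HN N (le_n N)). lra.
  - exists s. intros n. apply le_epsilon. intros eps he.
    destruct (hs eps he) as [N HN].
    replace (s - csum f n)%C with
      ((csum f (max n N) - csum f n) - (csum f (max n N) - s))%C by ring.
    eapply Rle_trans; [apply Cmod_minus|].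
    specialize (HN (max n N) ltac:(lia)). assert (t := T n (max n N) ltac:(lia)). lra.
Qed.

(* The derivative n z^(n-1), without a truncated predecessor. *)
Fixpoint pow_deriv (z : C) (n : nat) : C :=
  match n with O => 0 | S n => (z * pow_deriv z n + z ^ n)%C end.

(** The estimate |n z^(n-1)| <= n R^(n-1), multiplied by R to avoid the exponent n - 1. *)
Lemma Cmod_pow_deriv (z : C) (R : R) (n : nat) :
  Cmod z <= R -> R * Cmod (pow_deriv z n) <= INR n * R ^ n.
Proof.
  intros hz. assert (p := Cmod_ge_0 z).
  induction n as [|n IH]; [simpl; rewrite Cmod_0; lra|].
  rewrite S_INR. simpl.
  assert (t := Cmod_triangle (z * pow_deriv z n) (z ^ n)).
  rewrite Cmod_mult, Cmod_pow in t.
  assert (q : Cmod z ^ n <= R ^ n) by (apply pow_incr; lra).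
  assert (d := Cmod_ge_0 (pow_deriv z n)).
  apply (Rmult_le_compat_l R) in t; [|lra].
  assert (R * (Cmod z * Cmod (pow_deriv z n)) <= R * (INR n * R ^ n)).
  { apply Rmult_le_compat_l; [lra|]. eapply Rle_trans; [|exact IH].
    apply Rmult_le_compat_r; lra. }
  assert (R * Cmod z ^ n <= R * R ^ n) by (apply Rmult_le_compat_l; lra). lra.
Qed.

(** If d_n is the second-order error of z^n, then d_(n+1) = (z + h) d_n + h^2 (n z^(n-1)); the
    induction closes because n^2 + n <= (n+1)^2. The factor R^2 on the left replaces R^(n-2) on the
    right. *)
Lemma pow_taylor_bound (z h : C) (R : R) (n : nat) :
  Cmod z <= R -> Cmod (z + h) <= R ->
  R ^ 2 * Cmod ((z + h) ^ n - z ^ n - pow_deriv z n * h) <= INR n ^ 2 * R ^ n * Cmod h ^ 2.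
Proof.
  intros hz hzh. assert (p := Cmod_ge_0 z).
  induction n as [|n IH].
  - simpl. replace (1 - 1 - 0 * h)%C with (RtoC 0) by ring. rewrite Cmod_0. lra.
  - assert (D := Cmod_pow_deriv z R n hz).
    set (d := ((z + h) ^ n - z ^ n - pow_deriv z n * h)%C) in *.
    replace ((z + h) ^ S n - z ^ S n - pow_deriv z (S n) * h)%C
      with ((z + h) * d + h * h * pow_deriv z n)%C by (unfold d; simpl; ring).
    rewrite S_INR.
    assert (t := Cmod_triangle ((z + h) * d) (h * h * pow_deriv z n)).
    rewrite !Cmod_mult in t.
    assert (pn := pos_INR n). assert (pd := Cmod_ge_0 d). assert (ph := Cmod_ge_0 h).
    assert (ppd := Cmod_ge_0 (pow_deriv z n)).
    assert (pR : 0 <= R ^ n) by (apply pow_le; lra).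
    assert (hR : 0 <= R) by lra.
    apply (Rmult_le_compat_l (R ^ 2)) in t; [|nra].
    eapply Rle_trans; [exact t|].
    assert (t1 : R ^ 2 * (Cmod (z + h) * Cmod d) <= R * (INR n ^ 2 * R ^ n * Cmod h ^ 2)).
    { transitivity (R * (R ^ 2 * Cmod d)); [|apply Rmult_le_compat_l; lra].
      replace (R ^ 2 * (Cmod (z + h) * Cmod d)) with (Cmod (z + h) * (R ^ 2 * Cmod d)) by ring.
      apply Rmult_le_compat_r; [|exact hzh]. apply Rmult_le_pos; nra. }
    assert (t2 : R ^ 2 * (Cmod h * Cmod h * Cmod (pow_deriv z n)) <=
                 R * Cmod h ^ 2 * (INR n * R ^ n)).
    { transitivity (R * Cmod h ^ 2 * (R * Cmod (pow_deriv z n))); [right; ring|].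
      apply Rmult_le_compat_l; [|exact D]. apply Rmult_le_pos; nra. }
    assert (t3 : 0 <= R * Cmod h ^ 2 * R ^ n).
    { apply Rmult_le_pos; [|exact pR]. apply Rmult_le_pos; nra. }
    assert (t4 : 0 <= INR n * (R * Cmod h ^ 2 * R ^ n)) by (apply Rmult_le_pos; lra).
    simpl pow in *. nra.
Qed.

Lemma INR_le_pow2 (n : nat) : INR n <= 2 ^ n.
Proof.
  induction n as [|n IH]; [simpl; lra|]. rewrite S_INR. simpl.
  assert (1 <= 2 ^ n) by (apply pow_R1_Rle; lra). lra.
Qed.

(** F is the sum of the power series, and its derivative is the sum of the differentiated series.
    The error of the difference quotient is summed term by term from [pow_taylor_bound]. *)
Lemma expands_holomorphic (M : R) (z0 : C) (u : R -> C) (a : nat -> C) :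
  0 < M -> expands M z0 u a ->
  exists F, holomorphic_on_disk z0 (/ (8 * M)) F /\
    forall t, in_disk z0 (/ (8 * M)) (expi t) -> F (expi t) = u t.
Proof.
  intros hM [ha hu].
  set (R := / (8 * M)) in *. assert (hR : 0 < R) by (apply Rinv_0_lt_compat; lra).
  assert (eR : M * R = / 8) by (unfold R; field; lra).
  (* Used with k = 1 for the terms, k = 2 for their derivatives (n <= 2^n) and k = 4 for the
     second-order errors (n^2 <= 4^n). *)
  assert (MRpow : forall n k, 0 <= k <= 4 -> M ^ n * (k ^ n * R ^ n) <= (/ 2) ^ n).
  { intros n k hk. rewrite <- !Rpow_mult_distr. apply pow_incr.
    replace (M * (k * R)) with (k * (M * R)) by ring. rewrite eR. lra. }
  (* The disk condition stands inside the existential so that choice yields a total F, with an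
     arbitrary value off the disk. *)
  assert (conv : forall z, exists s, Cmod (z - z0) < R -> forall n,
    Cmod (s - csum (fun n => a n * (z - z0) ^ n) n)%C <= 2 * M * (/ 2) ^ n).
  { intros z. destruct (Rlt_dec (Cmod (z - z0)) R) as [hz|hz]; [|exists 0; intros; contradiction].
    destruct (geometric_series_converges (fun n => a n * (z - z0) ^ n)%C M) as [s hs].
    - intros n. rewrite Cmod_mult, Cmod_pow.
      assert (p := Cmod_ge_0 (z - z0)).
      transitivity (M * M ^ n * (1 ^ n * R ^ n)).
      + apply Rmult_le_compat; [apply Cmod_ge_0 | apply pow_le; lra | apply ha |].
        rewrite pow1, Rmult_1_l. apply pow_incr; lra.
      + rewrite Rmult_assoc. apply Rmult_le_compat_l; [lra|]. apply MRpow. lra.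
    - exists s. auto. }
  destruct (functional_choice _ conv) as [F hF].
  exists F. split.
  - unfold holomorphic_on_disk. change Cx with C.
    intros z hz. unfold in_disk in hz. rewrite Cnorm_Cmod in hz. change Csub with Cminus in hz.
    destruct (geometric_series_converges (fun n => a n * pow_deriv (z - z0) n)%C (M / R)) as [c hc].
    { intros n. rewrite Cmod_mult.
      apply (Rmult_le_reg_l R); [exact hR|].
      replace (R * (M / R * (/ 2) ^ n)) with (M * (/ 2) ^ n) by (field; lra).
      assert (D := Cmod_pow_deriv (z - z0) R n ltac:(lra)).
      assert (pR : 0 <= R ^ n) by (apply pow_le; lra).
      transitivity (M * M ^ n * (2 ^ n * R ^ n)).
      - replace (R * (Cmod (a n) * Cmod (pow_deriv (z - z0) n))) with
          (Cmod (a n) * (R * Cmod (pow_deriv (z - z0) n))) by ring.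
        apply Rmult_le_compat; [apply Cmod_ge_0 | | apply ha |].
        + apply Rmult_le_pos; [lra | apply Cmod_ge_0].
        + eapply Rle_trans; [exact D|]. apply Rmult_le_compat_r; [exact pR | apply INR_le_pow2].
      - rewrite Rmult_assoc. apply Rmult_le_compat_l; [lra|]. apply MRpow. lra. }
    exists c. intros eps heps.
    set (K := M / R ^ 2). assert (hR2 : 0 < R ^ 2) by (apply pow_lt; lra).
    assert (hK : 0 < K) by (apply Rdiv_lt_0_compat; lra).
    (* The first bound keeps z + h in the disk, the second makes 2 K |h| at most eps. *)
    exists (Rmin (R - Cmod (z - z0)) (eps / (2 * K))). split.
    { apply Rmin_pos; [lra|]. apply Rdiv_lt_0_compat; lra. }
    intros h [hh1 hh2]. rewrite !Cnorm_Cmod in *.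
    change Csub with Cminus. change Cadd with Cplus. change Cmul with Cmult.
    assert (hd1 := Rlt_le_trans _ _ _ hh2 (Rmin_l _ _)).
    assert (hd2 := Rlt_le_trans _ _ _ hh2 (Rmin_r _ _)).
    assert (hzh : Cmod (z + h - z0) < R).
    { replace (z + h - z0)%C with ((z - z0) + h)%C by ring.
      eapply Rle_lt_trans; [apply Cmod_triangle|]. lra. }
    transitivity (2 * K * Cmod h ^ 2).
    2:{ apply (Rmult_lt_compat_l (2 * K)) in hd2; [|lra].
        replace (2 * K * (eps / (2 * K))) with eps in hd2 by (field; lra).
        replace (2 * K * Cmod h ^ 2) with (2 * K * Cmod h * Cmod h) by ring.
        apply Rmult_le_compat_r; lra. }
    (* Each series is cut at order N. The constant collects the three truncation errors, for F (z +
       h), F z and c h; all decay like 2^(-N). *)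
    apply (le_geometric_le _ _ (2 * M + 2 * M + 2 * (M / R) * Cmod h)).
    intros N.
    assert (e1 := hF _ hzh N). assert (e2 := hF _ hz N). specialize (hc N).
    set (d := fun n => (a n * ((z - z0 + h) ^ n - (z - z0) ^ n - pow_deriv (z - z0) n * h))%C).
    assert (hd : Cmod (csum d N) <= 2 * (K * Cmod h ^ 2)).
    { assert (T := csum_geometric_tail d (K * Cmod h ^ 2) 0 N).
      change (csum d 0) with (RtoC 0) in T. rewrite Nat.add_0_l, pow_O in T.
      replace (csum d N - 0)%C with (csum d N) in T by ring.
      eapply Rle_trans; [apply T|].
      - intros n. unfold d. rewrite Cmod_mult.
        assert (B := pow_taylor_bound (z - z0) h R n ltac:(lra)).
        replace (z - z0 + h)%C with (z + h - z0)%C in * by ring.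
        specialize (B ltac:(lra)).
        apply (Rmult_le_reg_l (R ^ 2)); [exact hR2|].
        replace (R ^ 2 * (K * Cmod h ^ 2 * (/ 2) ^ n)) with (M * (/ 2) ^ n * Cmod h ^ 2)
          by (unfold K; field; lra).
        match goal with |- _ * (_ * ?x) <= _ =>
          replace (R ^ 2 * (Cmod (a n) * x)) with (Cmod (a n) * (R ^ 2 * x)) by ring;
          assert (px : 0 <= x) by apply Cmod_ge_0 end.
        assert (pR : 0 <= R ^ n) by (apply pow_le; lra).
        assert (ph : 0 <= Cmod h ^ 2) by (apply pow_le; lra).
        transitivity (M * M ^ n * (4 ^ n * R ^ n * Cmod h ^ 2)).
        + apply Rmult_le_compat; [apply Cmod_ge_0 | nra | apply ha |].
          eapply Rle_trans; [exact B|].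
          apply Rmult_le_compat_r; [exact ph|]. apply Rmult_le_compat_r; [exact pR|].
          replace (4 ^ n) with ((2 ^ n) ^ 2)
            by (rewrite <- pow_mult, Nat.mul_comm, pow_mult; f_equal; lra).
          apply pow_incr. split; [apply pos_INR | apply INR_le_pow2].
        + replace (M * M ^ n * (4 ^ n * R ^ n * Cmod h ^ 2)) with
            (M * (M ^ n * (4 ^ n * R ^ n)) * Cmod h ^ 2) by ring.
          apply Rmult_le_compat_r; [exact ph|]. apply Rmult_le_compat_l; [lra|].
          apply MRpow. lra.
      - assert (0 <= (/ 2) ^ N) by (apply pow_le; lra).
        assert (0 <= K * Cmod h ^ 2) by (apply Rmult_le_pos; nra). nra. }
    assert (ed : csum d N = (csum (fun n => a n * (z + h - z0) ^ n) N
      - csum (fun n => a n * (z - z0) ^ n) N - h * csum (fun n => a n * pow_deriv (z - z0) n) N)%C).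
    { rewrite <- csum_scal, <- !csum_minus. apply csum_ext. intros n _. unfold d.
      replace (z - z0 + h)%C with (z + h - z0)%C by ring. ring. }
    match type of e1 with Cmod (_ - ?x) <= _ => set (s1 := x) in * end.
    match type of e2 with Cmod (_ - ?x) <= _ => set (s2 := x) in * end.
    match type of hc with Cmod (_ - ?x) <= _ => set (s3 := x) in * end.
    replace (F (z + h) - F z - c * h)%C with
      (csum d N + (F (z + h) - s1) - (F z - s2) - h * (c - s3))%C by (rewrite ed; ring).
    eapply Rle_trans; [apply Cmod_minus|].
    eapply Rle_trans; [apply Rplus_le_compat_r, Cmod_minus|].
    eapply Rle_trans; [apply Rplus_le_compat_r, Rplus_le_compat_r, Cmod_triangle|].
    rewrite Cmod_mult.
    assert (p := Rmult_le_compat_l _ _ _ (Cmod_ge_0 h) hc). lra.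
  - intros t ht. unfold in_disk in ht. rewrite Cnorm_Cmod in ht. change Csub with Cminus in ht.
    assert (e : Cmod (F (expi t) - u t) <= 0).
    { apply (le_geometric_le _ _ (2 * M + M)). intros N.
      assert (e1 := hF _ ht N). assert (e2 := hu _ ht N).
      match type of e1 with Cmod (_ - ?x) <= _ => set (s := x) in * end.
      replace (F (expi t) - u t)%C with ((F (expi t) - s) - (u t - s))%C by ring.
      eapply Rle_trans; [apply Cmod_minus|].
      assert (q : (M * Cmod (expi t - z0)) ^ N <= (/ 2) ^ N).
      { apply pow_incr. assert (p := Cmod_ge_0 (expi t - z0)). split; nra. }
      apply (Rmult_le_compat_l M) in q; [|lra]. lra. }
    assert (e0 := Cmod_eq_0 _ (Rle_antisym _ _ e (Cmod_ge_0 _))).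
    change (@eq C (F (expi t)) (u t)).
    replace (F (expi t)) with (F (expi t) - u t + u t)%C by ring. rewrite e0. ring.
Qed.

(** * Expansions along the arc *)

Lemma Cmod_csum_le (f : nat -> C) (N : nat) (e : R) :
  (forall n, (n < N)%nat -> Cmod (f n) <= e) -> Cmod (csum f N) <= INR N * e.
Proof.
  induction N as [|N IH]; intros H.
  - simpl. rewrite Cmod_0. lra.
  - rewrite S_INR. simpl. eapply Rle_trans; [apply Cmod_triangle|].
    specialize (H N ltac:(lia)) as h. specialize (IH ltac:(intros; apply H; lia)). lra.
Qed.

Lemma chord_sqr (t t0 : R) : Cmod (expi t - expi t0) ^ 2 = 2 * (1 - cos (t - t0)).
Proof.
  rewrite Cmod2_alt, cos_minus. unfold expi; simpl.
  assert (h := sin2_cos2 t). assert (h0 := sin2_cos2 t0). unfold Rsqr in *. nra.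
Qed.

(** A rotation by s = min(1, r) gives the chord 2 sin(s/2), which lies strictly between 0 and s.
    Such points let one divide by powers of the chord. *)
Lemma short_chord_exists (t0 r : R) :
  0 < r -> exists t, 0 < Cmod (expi t - expi t0) <= r.
Proof.
  intros hr. set (s := Rmin 1 r).
  assert (hs : 0 < s) by (apply Rmin_pos; lra).
  assert (hs1 : s <= 1) by apply Rmin_l. assert (hsr : s <= r) by apply Rmin_r.
  exists (t0 + s). assert (E := chord_sqr (t0 + s) t0).
  replace (t0 + s - t0) with (2 * (s / 2)) in E by field.
  rewrite cos_2a_sin in E.
  assert (p1 : 0 < sin (s / 2)).
  { apply sin_gt_0; [lra|]. assert (h := PI2_1). lra. }
  assert (p2 := sin_lt_x (s / 2) ltac:(lra)).
  assert (p := Cmod_ge_0 (expi (t0 + s) - expi t0)).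
  split; nra.
Qed.

Section Arc.
Variables (t0 M K : R).
Hypotheses (hM : 0 < M) (hK : 0 <= K).

Definition chord (t : R) : C := (expi t - expi t0)%C.

(** The remainder half of [expands], with K separate from M: the difference of two expansions keeps
    the ratio M but has constant 2 M. *)
Definition geometric_remainder (f : R -> C) (d : nat -> C) : Prop :=
  forall t, Cmod (chord t) < / (8 * M) -> forall N,
    Cmod (f t - csum (fun n => d n * chord t ^ n) N)%C <= K * (M * Cmod (chord t)) ^ N.

Lemma coefficient_bound (f : R -> C) (d : nat -> C) (j : nat) (t : R) :
  geometric_remainder f d -> Cmod (chord t) < / (8 * M) ->
  Cmod (d j) * Cmod (chord t) ^ j <=
    Cmod (f t) + Cmod (csum (fun n => d n * chord t ^ n)%C j)
    + K * M ^ S j * Cmod (chord t) * Cmod (chord t) ^ j.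
Proof.
  intros hd ht. specialize (hd t ht (S j)). simpl in hd.
  set (s := csum _ j) in *.
  rewrite <- Cmod_pow, <- Cmod_mult.
  replace (d j * chord t ^ j)%C with
    (f t - s - (f t - (s + d j * chord t ^ j)))%C by ring.
  eapply Rle_trans; [apply Cmod_minus|].
  assert (t1 := Cmod_minus (f t) s).
  rewrite Cmod_pow. rewrite Rpow_mult_distr in hd. simpl. lra.
Qed.

(* Smallness on the arc controls every coefficient, at a rate depending only on
   the remainder bound: this replaces Montel's theorem. *)
Lemma coefficient_control (j : nat) : forall eps, 0 < eps ->
  exists delta, 0 < delta /\ forall f d, geometric_remainder f d ->
    (forall t, Cmod (f t) <= delta) -> forall i, (i < j)%nat -> Cmod (d i) <= eps.
Proof.
  induction j as [|j IH]; intros eps he.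
  { exists 1. split; [lra|]. intros; lia. }
  assert (hMj : 0 <= K * M ^ S j) by (apply Rmult_le_pos; [lra | apply pow_le; lra]).
  set (A := K * M ^ S j) in *.
  (* Three demands on the chord: powers at most 1, a point inside the arc, and a next-order error of
     at most eps / 3 relative to |chord|^j. *)
  set (r := Rmin 1 (Rmin (/ (16 * M)) (eps / (3 * (A + 1))))).
  assert (hr : 0 < r).
  { repeat apply Rmin_pos; [lra | apply Rinv_0_lt_compat; lra | apply Rdiv_lt_0_compat; lra]. }
  assert (r1 : r <= 1) by apply Rmin_l.
  assert (r2 : r <= / (16 * M)) by (eapply Rle_trans; [apply Rmin_r | apply Rmin_l]).
  assert (r3 : r <= eps / (3 * (A + 1))) by (eapply Rle_trans; [apply Rmin_r | apply Rmin_r]).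
  destruct (short_chord_exists t0 r hr) as [t [ht1 ht2]]. fold (chord t) in ht1, ht2.
  assert (h8 : Cmod (chord t) < / (8 * M)).
  { eapply Rle_lt_trans; [exact ht2|]. eapply Rle_lt_trans; [exact r2|].
    apply Rinv_lt_contravar; nra. }
  assert (hA : A * Cmod (chord t) <= eps / 3).
  { apply (Rle_trans _ ((A + 1) * r)); [nra|].
    apply (Rmult_le_compat_l (A + 1)) in r3; [|lra].
    replace ((A + 1) * (eps / (3 * (A + 1)))) with (eps / 3) in r3 by (field; lra). lra. }
  set (p := Cmod (chord t) ^ j). assert (hp : 0 < p) by now apply pow_lt.
  (* The chord, hence p, is fixed before f and d appear, so dividing by p is uniform. The j lower
     terms, each at most e', then add up to at most eps / 3 * p. *)
  set (e' := Rmin eps (eps / 3 * p / (INR j + 1))).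
  assert (pj := pos_INR j).
  assert (he' : 0 < e').
  { apply Rmin_pos; [lra|]. apply Rdiv_lt_0_compat; [apply Rmult_lt_0_compat|]; lra. }
  destruct (IH e' he') as [delta [hdel IHd]].
  exists (Rmin delta (eps / 3 * p)). split.
  { apply Rmin_pos; [exact hdel | apply Rmult_lt_0_compat; lra]. }
  intros f d hd hf.
  assert (low : forall i, (i < j)%nat -> Cmod (d i) <= e').
  { apply (IHd f d hd). intros s. eapply Rle_trans; [apply hf | apply Rmin_l]. }
  intros i hi. destruct (Nat.eq_dec i j) as [->|ne].
  2:{ eapply Rle_trans; [apply low; lia | apply Rmin_l]. }
  assert (B := coefficient_bound f d j t hd h8). fold A p in B.
  assert (S : Cmod (csum (fun n => d n * chord t ^ n)%C j) <= eps / 3 * p).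
  { eapply Rle_trans; [apply (Cmod_csum_le _ j e')|].
    - intros n hn. rewrite Cmod_mult, Cmod_pow.
      assert (q : Cmod (chord t) ^ n <= 1 ^ n) by (apply pow_incr; lra).
      rewrite pow1 in q. specialize (low n hn).
      assert (dn := Cmod_ge_0 (d n)). nra.
    - assert (e2 : e' <= eps / 3 * p / (INR j + 1)) by apply Rmin_r.
      apply (Rmult_le_compat_l (INR j + 1)) in e2; [|lra].
      replace ((INR j + 1) * (eps / 3 * p / (INR j + 1))) with (eps / 3 * p) in e2 by (field; lra).
      lra. }
  assert (F := Rle_trans _ _ _ (hf t) (Rmin_r _ _)).
  apply (Rmult_le_reg_r p); [exact hp|].
  apply (Rmult_le_compat_r p) in hA; lra.
Qed.

(** If the coefficients below j vanish, then d j chord^j is f up to O(chord^(j+1)), and flatness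
    makes f itself O(chord^(j+1)); letting the chord shrink gives d j = 0. *)
Lemma flat_expansion_vanishes (f : R -> C) (d : nat -> C) :
  geometric_remainder f d ->
  (forall n, exists B, forall t, Cmod (chord t) <= 1 -> Cmod (f t) <= B * Cmod (chord t) ^ n) ->
  forall t, Cmod (chord t) < / (8 * M) -> Cmod (f t) <= 0.
Proof.
  intros hd hflat.
  assert (zero : forall j, d j = 0).
  { intros j. induction j as [j IH] using lt_wf_ind.
    apply Cmod_eq_0, Rle_antisym; [|apply Cmod_ge_0].
    apply le_epsilon. intros eps he. rewrite Rplus_0_l.
    destruct (hflat (S j)) as [B hB].
    assert (hMj : 0 <= K * M ^ S j) by (apply Rmult_le_pos; [lra | apply pow_le; lra]).
    set (A := K * M ^ S j) in *.
    assert (pB := Rabs_pos B). assert (BB := Rle_abs B).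
    set (r := Rmin 1 (Rmin (/ (16 * M)) (eps / (Rabs B + A + 1)))).
    assert (hr : 0 < r).
    { repeat apply Rmin_pos; [lra | apply Rinv_0_lt_compat; lra | apply Rdiv_lt_0_compat; lra]. }
    assert (r1 : r <= 1) by apply Rmin_l.
    assert (r2 : r <= / (16 * M)) by (eapply Rle_trans; [apply Rmin_r | apply Rmin_l]).
    assert (r3 : r <= eps / (Rabs B + A + 1)) by (eapply Rle_trans; [apply Rmin_r | apply Rmin_r]).
    destruct (short_chord_exists t0 r hr) as [t [ht1 ht2]]. fold (chord t) in ht1, ht2.
    assert (h8 : Cmod (chord t) < / (8 * M)).
    { eapply Rle_lt_trans; [exact ht2|]. eapply Rle_lt_trans; [exact r2|].
      apply Rinv_lt_contravar; nra. }
    assert (C0 := coefficient_bound f d j t hd h8). fold A in C0.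
    rewrite (csum_ext _ (fun _ => 0 * 0)%C) in C0.
    2:{ intros n hn. rewrite (IH n hn). ring. }
    rewrite csum_scal in C0.
    replace (0 * csum (fun _ => 0) j)%C with (RtoC 0) in C0 by ring. rewrite Cmod_0 in C0.
    specialize (hB t ltac:(lra)). simpl in hB.
    set (p := Cmod (chord t) ^ j) in *. assert (hp : 0 < p) by now apply pow_lt.
    apply (Rmult_le_reg_r p); [exact hp|].
    assert (q : (Rabs B + A + 1) * Cmod (chord t) <= eps).
    { apply (Rle_trans _ ((Rabs B + A + 1) * r)); [nra|].
      apply (Rmult_le_compat_l (Rabs B + A + 1)) in r3; [|lra].
      replace ((Rabs B + A + 1) * (eps / (Rabs B + A + 1))) with eps in r3 by (field; lra). lra. }
    apply (Rmult_le_compat_r p) in q; [|lra].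
    assert (cp : 0 < Cmod (chord t) * p) by nra. nra. }
  (* With all coefficients zero the remainder bound reads |f t| <= K (M |chord|)^N for every N, and
     M |chord| < 1/8. *)
  intros t ht. apply (le_geometric_le _ _ K). intros N. rewrite Rplus_0_l.
  specialize (hd t ht N).
  rewrite (csum_ext _ (fun _ => 0 * 0)%C) in hd by (intros; rewrite zero; ring).
  rewrite csum_scal in hd.
  replace (f t - 0 * csum (fun _ => 0) N)%C with (f t) in hd by ring.
  eapply Rle_trans; [exact hd|]. apply Rmult_le_compat_l; [exact hK|].
  apply pow_incr. assert (p := Cmod_ge_0 (chord t)). split; [nra|].
  apply (Rmult_lt_compat_l M) in ht; [|exact hM].
  replace (M * / (8 * M)) with (/ 8) in ht by (field; lra). lra.
Qed.
End Arc.

Lemma csum_converges (a : nat -> nat -> C) (b : nat -> C) (z : C) (N : nat) :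
  (forall j eps, 0 < eps -> exists m0, forall m, (m0 <= m)%nat -> Cmod (a m j - b j) <= eps) ->
  forall eps, 0 < eps -> exists m0, forall m, (m0 <= m)%nat ->
    Cmod (csum (fun n => a m n * z ^ n) N - csum (fun n => b n * z ^ n) N)%C <= eps.
Proof.
  intros H. induction N as [|N IH]; intros eps he.
  - exists O. intros m _. simpl. replace (0 - 0)%C with (RtoC 0) by ring.
    rewrite Cmod_0. lra.
  - destruct (IH (eps / 2)) as [m1 h1]; [lra|].
    assert (pz : 0 <= Cmod z ^ N) by (apply pow_le, Cmod_ge_0).
    destruct (H N (eps / 2 / (Cmod z ^ N + 1))) as [m2 h2].
    { apply Rdiv_lt_0_compat; lra. }
    exists (max m1 m2). intros m hm. simpl.
    specialize (h1 m ltac:(lia)). specialize (h2 m ltac:(lia)).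
    match goal with |- Cmod (?x + _ - (?y + _)) <= _ =>
      replace (x + a m N * z ^ N - (y + b N * z ^ N))%C
        with ((x - y) + (a m N - b N) * z ^ N)%C by ring end.
    eapply Rle_trans; [apply Cmod_triangle|]. rewrite Cmod_mult, Cmod_pow.
    apply (Rmult_le_compat_r (Cmod z ^ N + 1)) in h2; [|lra].
    replace (eps / 2 / (Cmod z ^ N + 1) * (Cmod z ^ N + 1)) with (eps / 2) in h2 by (field; lra).
    assert (d := Cmod_ge_0 (a m N - b N)). lra.
Qed.

(** For approximants v n of u, the differences v n - v m are uniformly small and have remainder
    constant 2 M, so [coefficient_control] makes each coefficient sequence Cauchy. The limits
    inherit both inequalities, index by index. *)
Lemma expands_closed (t0 M : R) (u : R -> C) :
  0 < M ->
  (forall eps, 0 < eps -> exists v a,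
    (forall t, Cmod (v t - u t) <= eps) /\ expands M (expi t0) v a) ->
  exists a, expands M (expi t0) u a.
Proof.
  intros hM H.
  destruct (functional_choice (fun (m : nat) (va : (R -> C) * (nat -> C)) =>
    (forall t, Cmod (fst va t - u t) <= (/ 2) ^ m) /\ expands M (expi t0) (fst va) (snd va)))
    as [va hva].
  { intros m. destruct (H ((/ 2) ^ m)) as (v & a & h); [apply pow_lt; lra|].
    now exists (v, a). }
  set (v := fun m => fst (va m)) in *. set (a := fun m => snd (va m)) in *.
  assert (cl : forall m t, Cmod (v m t - u t) <= (/ 2) ^ m) by (intros; apply hva).
  assert (ex : forall m, expands M (expi t0) (v m) (a m)) by (intros; apply hva).
  clearbody v a. clear va hva.
  assert (lim : forall j, exists b, forall eps, 0 < eps ->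
    exists m0, forall m, (m0 <= m)%nat -> Cmod (a m j - b) <= eps).
  { intros j. apply (C_complete (fun m => a m j)). intros eps he.
    destruct (coefficient_control t0 M (2 * M) hM ltac:(lra) (S j) eps he) as [delta [hd hc]].
    destruct (geometric_arbitrarily_small 2 delta hd) as [m0 hm0].
    exists m0. intros n m hn hm.
    apply (hc (fun t => v n t - v m t)%C (fun i => a n i - a m i)%C); [| |lia].
    - intros t ht N.
      destruct (ex n) as [_ en]. destruct (ex m) as [_ em].
      specialize (en t ht N). specialize (em t ht N). fold (chord t0 t) in en, em.
      rewrite (csum_ext _ (fun i => a n i * chord t0 t ^ i - a m i * chord t0 t ^ i)%C)
        by (intros; ring).
      rewrite csum_minus.
      match goal with |- Cmod (?x - ?y - (?p - ?q)) <= _ =>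
        replace (x - y - (p - q))%C with ((x - p) - (y - q))%C by ring end.
      eapply Rle_trans; [apply Cmod_minus|]. lra.
    - intros t. replace (v n t - v m t)%C with ((v n t - u t) - (v m t - u t))%C by ring.
      eapply Rle_trans; [apply Cmod_minus|].
      assert (h1 := cl n t). assert (h2 := cl m t).
      assert (h3 := hm0 n hn). assert (h4 := hm0 m hm). lra. }
  destruct (functional_choice _ lim) as [b hb]. exists b. split.
  - intros n. apply le_epsilon. intros eps he. destruct (hb n eps he) as [m0 hm0].
    specialize (hm0 m0 (le_n m0)). destruct (ex m0) as [ea _].
    replace (b n) with (a m0 n - (a m0 n - b n))%C by ring.
    eapply Rle_trans; [apply Cmod_minus|]. specialize (ea n). lra.
  - intros t ht N. apply le_epsilon. intros eps he.
    destruct (csum_converges a b (expi t - expi t0)%C N hb (eps / 2)) as [m1 h1]; [lra|].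
    destruct (geometric_arbitrarily_small 1 (eps / 2)) as [m2 h2]; [lra|].
    specialize (h1 (max m1 m2) ltac:(lia)). specialize (h2 (max m1 m2) ltac:(lia)).
    set (m := max m1 m2) in *. destruct (ex m) as [_ em]. specialize (em t ht N).
    specialize (cl m t).
    match type of h1 with Cmod (?x - ?y) <= _ => set (p := x) in *; set (q := y) in * end.
    replace (u t - q)%C with ((v m t - p) + (p - q) - (v m t - u t))%C by ring.
    eapply Rle_trans; [apply Cmod_minus|].
    eapply Rle_trans; [apply Rplus_le_compat_r, Cmod_triangle|]. lra.
Qed.

(** * A flat smooth function, and the theorem *)

Lemma pow_le_fact_exp (n : nat) (y : R) : 0 <= y -> y ^ n <= INR (fact n) * exp y.
Proof.
  intros hy. assert (T := exp_ge_taylor y n hy).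
  assert (pf : 0 < INR (fact n)) by apply INR_fact_lt_0.
  assert (L : y ^ n / INR (fact n) <= sum_f_R0 (fun k => y ^ k / INR (fact k)) n).
  { destruct n as [|n]; [simpl; lra|]. rewrite tech5.
    assert (0 <= sum_f_R0 (fun k => y ^ k / INR (fact k)) n); [|lra].
    apply cond_pos_sum. intros k. apply Rdiv_le_0_compat; [now apply pow_le | apply INR_fact_lt_0]. }
  apply (Rmult_le_reg_l (/ INR (fact n))); [now apply Rinv_0_lt_compat|].
  rewrite <- Rmult_assoc, Rinv_l, Rmult_1_l by lra. lra.
Qed.

(** The powers 1 / x^m make the family stable under differentiation: the derivative of [flat m] is a
    combination of [flat (m + 2)] and [flat (m + 1)]. *)
Definition flat (m : nat) (x : R) : R :=
  if Rle_dec x 0 then 0 else exp (- / x) * / x ^ m.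

Lemma flat_nonpos (m : nat) (x : R) : x <= 0 -> flat m x = 0.
Proof. intros h. unfold flat. destruct (Rle_dec x 0); [reflexivity | lra]. Qed.

Lemma flat_pos_eq (m : nat) (x : R) : 0 < x -> flat m x = exp (- / x) * / x ^ m.
Proof. intros h. unfold flat. destruct (Rle_dec x 0); [lra | reflexivity]. Qed.

Lemma flat_pos (m : nat) (x : R) : 0 < x -> 0 < flat m x.
Proof.
  intros h. rewrite flat_pos_eq by exact h.
  apply Rmult_lt_0_compat; [apply exp_pos | apply Rinv_0_lt_compat, pow_lt; lra].
Qed.

(** From y^(m+n) <= (m+n)! e^y at y = 1 / x. The case n = 0 gives boundedness, n = 2 the derivative
    at 0, and general n the flatness of the bump. *)
Lemma flat_bound (m n : nat) (x : R) :
  Rabs (flat m x) <= INR (fact (m + n)) * Rabs x ^ n.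
Proof.
  assert (pf : 0 < INR (fact (m + n))) by apply INR_fact_lt_0.
  destruct (Rle_dec x 0) as [h|h].
  - rewrite flat_nonpos, Rabs_R0 by exact h.
    apply Rmult_le_pos; [lra | apply pow_le, Rabs_pos].
  - assert (hx : 0 < x) by lra.
    rewrite Rabs_pos_eq by (left; now apply flat_pos).
    rewrite flat_pos_eq, (Rabs_pos_eq x) by lra.
    assert (iy : 0 < / x) by now apply Rinv_0_lt_compat.
    assert (B := pow_le_fact_exp (m + n) (/ x) ltac:(lra)).
    rewrite exp_Ropp, <- pow_inv. rewrite pow_add in B.
    assert (pe := exp_pos (/ x)). assert (px : 0 < x ^ n) by now apply pow_lt.
    assert (en : (/ x) ^ n * x ^ n = 1).
    { rewrite <- Rpow_mult_distr, Rinv_l by lra. apply pow1. }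
    apply (Rmult_le_compat_r (x ^ n)) in B; [|lra].
    rewrite Rmult_assoc, en, Rmult_1_r in B.
    apply (Rmult_le_reg_l (exp (/ x))); [exact pe|].
    rewrite <- Rmult_assoc, Rinv_r, Rmult_1_l by lra.
    eapply Rle_trans; [exact B|]. right; ring.
Qed.

Lemma flat_derivable (m : nat) (x : R) :
  derivable_pt_lim (flat m) x (flat (m + 2) x - INR m * flat (m + 1) x).
Proof.
  destruct (Rtotal_order x 0) as [h|[->|h]].
  - rewrite !flat_nonpos by lra. apply is_derive_Reals.
    apply (is_derive_ext_loc (fun _ => 0)).
    + exists (mkposreal (- x) ltac:(lra)). intros y hy. symmetry. apply flat_nonpos.
      unfold ball in hy; simpl in hy. unfold AbsRing_ball, abs, minus, plus, opp in hy; simpl in hy.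
      apply Rabs_lt_between in hy. lra.
    + replace (0 - INR m * 0) with 0 by ring. apply (is_derive_const (V := R_NormedModule)).
  - rewrite !(flat_nonpos _ 0) by lra. replace (0 - INR m * 0) with 0 by ring.
    intros eps he.
    (* At 0 the bound |flat m y| <= B y^2 makes the difference quotient at most B |y|. *)
    set (B := INR (fact (m + 2))). assert (hB : 0 < B) by apply INR_fact_lt_0.
    exists (mkposreal (eps / B) ltac:(now apply Rdiv_lt_0_compat)).
    intros y hy hy'. simpl in hy'.
    rewrite Rplus_0_l, (flat_nonpos _ 0), !Rminus_0_r by lra.
    unfold Rdiv. rewrite Rabs_mult, Rabs_inv.
    assert (py : 0 < Rabs y) by now apply Rabs_pos_lt.
    assert (F := flat_bound m 2 y). fold B in F.
    apply (Rmult_lt_reg_r (Rabs y)); [exact py|].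
    rewrite Rmult_assoc, Rinv_l, Rmult_1_r by lra.
    eapply Rle_lt_trans; [exact F|].
    apply (Rmult_lt_compat_l B) in hy'; [|exact hB].
    replace (B * (eps / B)) with eps in hy' by (field; lra). nra.
  - rewrite !flat_pos_eq by lra. apply is_derive_Reals.
    apply (is_derive_ext_loc (fun x => exp (- / x) * / x ^ m)).
    + exists (mkposreal x h). intros y hy. symmetry. apply flat_pos_eq.
      unfold ball in hy; simpl in hy. unfold AbsRing_ball, abs, minus, plus, opp in hy; simpl in hy.
      apply Rabs_lt_between in hy. lra.
    + assert (px : 0 < x ^ m) by now apply pow_lt.
      auto_derive.
      * repeat split; lra.
      * rewrite !pow_add. destruct m as [|m]; simpl pred; [simpl; field; lra|].
        assert (px' : 0 < x ^ m) by now apply pow_lt.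
        simpl pow. field. lra.
Qed.

Section Bump.
Variable t0 : R.

(** An algebra of bounded functions containing the bump and stable under differentiation: every
    derivative of the bump is thus smooth and bounded without an explicit formula. *)
Inductive bump_algebra : (R -> R) -> Prop :=
| bump_flat m : bump_algebra (fun t => flat m (1 - cos (t - t0)))
| bump_cos : bump_algebra (fun t => cos (t - t0))
| bump_sin : bump_algebra (fun t => sin (t - t0))
| bump_const c : bump_algebra (fun _ => c)
| bump_add f g : bump_algebra f -> bump_algebra g -> bump_algebra (fun t => f t + g t)
| bump_mul f g : bump_algebra f -> bump_algebra g -> bump_algebra (fun t => f t * g t).

Lemma shift_derivable (f : R -> R) (x l : R) :
  derivable_pt_lim f (x - t0) l -> derivable_pt_lim (fun t => f (t - t0)) x l.
Proof.
  intros h. replace l with (l * (1 - 0)) by ring.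
  apply (derivable_pt_lim_comp (fun t => t - t0) f); [|exact h].
  apply derivable_pt_lim_minus; [apply derivable_pt_lim_id | apply derivable_pt_lim_const].
Qed.

Lemma bump_algebra_derivative (f : R -> R) : bump_algebra f ->
  exists f', bump_algebra f' /\ forall x, derivable_pt_lim f x (f' x).
Proof.
  induction 1 as [m| | |c|f g _ [f' [hf df]] _ [g' [hg dg]]|f g Hf [f' [hf df]] Hg [g' [hg dg]]].
  - exists (fun t => (flat (m + 2) (1 - cos (t - t0))
        + - INR m * flat (m + 1) (1 - cos (t - t0))) * sin (t - t0)).
    split; [repeat constructor|]. intros x.
    apply (shift_derivable (fun s => flat m (1 - cos s))).
    match goal with |- derivable_pt_lim _ _ (?a * ?b) =>
      replace (a * b) with (a * (0 - - b)) by ring end.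
    apply (derivable_pt_lim_comp (fun s => 1 - cos s) (flat m)).
    + apply derivable_pt_lim_minus; [apply derivable_pt_lim_const | apply derivable_pt_lim_cos].
    + match goal with |- derivable_pt_lim _ _ (?a + - ?b * ?c) =>
        replace (a + - b * c) with (a - b * c) by ring end.
      apply flat_derivable.
  - exists (fun t => -1 * sin (t - t0)). split; [repeat constructor|]. intros x.
    apply (shift_derivable cos). replace (-1 * sin (x - t0)) with (- sin (x - t0)) by ring.
    apply derivable_pt_lim_cos.
  - exists (fun t => cos (t - t0)). split; [constructor|]. intros x.
    apply (shift_derivable sin), derivable_pt_lim_sin.
  - exists (fun _ => 0). split; [constructor|]. intros x. apply derivable_pt_lim_const.
  - exists (fun t => f' t + g' t). split; [now constructor|]. intros x.
    now apply derivable_pt_lim_plus.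
  - exists (fun t => f' t * g t + f t * g' t). split; [repeat (constructor; auto)|].
    intros x. now apply derivable_pt_lim_mult.
Qed.

Lemma bump_algebra_bounded (f : R -> R) : bump_algebra f ->
  exists B, forall t, Rabs (f t) <= B.
Proof.
  induction 1 as [m| | |c|f g _ [A hA] _ [B hB]|f g _ [A hA] _ [B hB]].
  - exists (INR (fact (m + 0))). intros t.
    assert (h := flat_bound m 0 (1 - cos (t - t0))). rewrite pow_O, Rmult_1_r in h. exact h.
  - exists 1. intros t. apply Rabs_le, COS_bound.
  - exists 1. intros t. apply Rabs_le, SIN_bound.
  - exists (Rabs c). intros _. lra.
  - exists (A + B). intros t. eapply Rle_trans; [apply Rabs_triang|]. now apply Rplus_le_compat.
  - exists (A * B). intros t. rewrite Rabs_mult.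
    apply Rmult_le_compat; auto; apply Rabs_pos.
Qed.

Definition bump (t : R) : C := (flat 0 (1 - cos (t - t0)), 0).

Lemma bump_nth_deriv (l : nat) :
  exists f, bump_algebra f /\ nth_deriv l bump (fun t => (f t, 0)).
Proof.
  induction l as [|l [f [hf df]]].
  - exists (fun t => flat 0 (1 - cos (t - t0))). split; [constructor|]. apply nth_deriv0.
  - destruct (bump_algebra_derivative f hf) as [f' [hf' df']].
    exists f'. split; [exact hf'|]. apply (nth_derivS _ _ _ _ df).
    intros x. split; [apply df' | apply derivable_pt_lim_const].
Qed.

Lemma bump_nth_deriv_continuous (l : nat) :
  exists h, nth_deriv l bump h /\ Ccontinuous h.
Proof.
  destruct (bump_nth_deriv l) as [f [hf df]].
  exists (fun t => (f t, 0)). split; [exact df|]. split.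
  - intros x. destruct (bump_algebra_derivative f hf) as [f' [_ df']].
    apply derivable_continuous_pt. exists (f' x). apply df'.
  - apply continuity_const. now intros x y.
Qed.

(** A basic neighbourhood constrains finitely many derivatives, even for k = [Inf], so one constant
    per N is what density requires. *)
Lemma bump_derivatives_bounded (N : nat) :
  exists B, 0 < B /\ forall l, (l <= N)%nat ->
    exists h, nth_deriv l bump h /\ forall t, Cmod (h t) <= B.
Proof.
  assert (one : forall l, exists B, exists h, nth_deriv l bump h /\ forall t, Cmod (h t) <= B).
  { intros l. destruct (bump_nth_deriv l) as [f [hf df]].
    destruct (bump_algebra_bounded f hf) as [B hB].
    exists B, (fun t => (f t, 0)). split; [exact df|]. intros t.
    change (f t, 0) with (RtoC (f t)). rewrite Cmod_R. apply hB. }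
  induction N as [|N [B [hB IH]]].
  - destruct (one O) as [B [h [dh bh]]]. exists (Rmax 1 B). split.
    { eapply Rlt_le_trans; [|apply Rmax_l]. lra. }
    intros l hl. replace l with O by lia. exists h. split; [exact dh|].
    intros t. eapply Rle_trans; [apply bh | apply Rmax_r].
  - destruct (one (S N)) as [B' [h [dh bh]]]. exists (Rmax B B'). split.
    { eapply Rlt_le_trans; [|apply Rmax_l]. lra. }
    intros l hl. destruct (Nat.eq_dec l (S N)) as [->|ne].
    + exists h. split; [exact dh|]. intros t. eapply Rle_trans; [apply bh | apply Rmax_r].
    + destruct (IH l ltac:(lia)) as [h' [dh' bh']]. exists h'. split; [exact dh'|].
      intros t. eapply Rle_trans; [apply bh' | apply Rmax_l].
Qed.

(** Here 1 - cos(t - t0) is half the squared chord, hence at most the chord once the chord is at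
    most 1; powers of x in [flat_bound] become powers of the chord. *)
Lemma bump_flat_at (n : nat) :
  exists B, forall t, Cmod (chord t0 t) <= 1 -> Cmod (bump t) <= B * Cmod (chord t0 t) ^ n.
Proof.
  exists (INR (fact (0 + n))). intros t ht.
  unfold bump. change (flat 0 (1 - cos (t - t0)), 0) with (RtoC (flat 0 (1 - cos (t - t0)))).
  rewrite Cmod_R. eapply Rle_trans; [apply (flat_bound 0 n)|].
  apply Rmult_le_compat_l; [left; apply INR_fact_lt_0|].
  assert (E := chord_sqr t t0). fold (chord t0 t) in E.
  assert (p := Cmod_ge_0 (chord t0 t)).
  apply pow_incr. split; [apply Rabs_pos|]. rewrite Rabs_pos_eq; nra.
Qed.

Lemma bump_neq0 (t : R) : 0 < Cmod (chord t0 t) -> 0 < Cmod (bump t).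
Proof.
  intros ht. assert (E := chord_sqr t t0). fold (chord t0 t) in E.
  unfold bump. change (flat 0 (1 - cos (t - t0)), 0) with (RtoC (flat 0 (1 - cos (t - t0)))).
  assert (q : 0 < flat 0 (1 - cos (t - t0))) by (apply flat_pos; nra).
  rewrite Cmod_R, Rabs_pos_eq; lra.
Qed.

Lemma bump_periodic (t : R) : bump (t + 2 * PI) = bump t.
Proof.
  unfold bump. do 3 f_equal. replace (t + 2 * PI - t0) with (t - t0 + 2 * INR 1 * PI) by (simpl; ring).
  now rewrite cos_period.
Qed.
End Bump.

(** * Perturbation by the bump, and the two halves of the theorem *)

Lemma is_deriv_scal (c : R) (g h : R -> C) :
  is_deriv g h -> is_deriv (fun t => RtoC c * g t)%C (fun t => RtoC c * h t)%C.
Proof.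
  intros H x. destruct (H x) as [h1 h2]. simpl. split.
  - replace (fun t => c * fst (g t) - 0 * snd (g t)) with (mult_real_fct c (fun t => fst (g t)))
      by (apply functional_extensionality; intros; unfold mult_real_fct; ring).
    replace (c * fst (h x) - 0 * snd (h x)) with (c * fst (h x)) by ring.
    now apply derivable_pt_lim_scal.
  - replace (fun t => c * snd (g t) + 0 * fst (g t)) with (mult_real_fct c (fun t => snd (g t)))
      by (apply functional_extensionality; intros; unfold mult_real_fct; ring).
    replace (c * snd (h x) + 0 * fst (h x)) with (c * snd (h x)) by ring.
    now apply derivable_pt_lim_scal.
Qed.

Lemma nth_deriv_scal (c : R) (l : nat) (g h : R -> C) :
  nth_deriv l g h -> nth_deriv l (fun t => RtoC c * g t)%C (fun t => RtoC c * h t)%C.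
Proof.
  induction 1 as [g|l g h h' _ IH d]; [apply nth_deriv0|].
  apply (nth_derivS _ _ _ _ IH). now apply is_deriv_scal.
Qed.

Lemma nth_deriv_plus (l : nat) (f f' g g' : R -> C) :
  nth_deriv l f f' -> nth_deriv l g g' ->
  nth_deriv l (fun t => f t + g t)%C (fun t => f' t + g' t)%C.
Proof.
  intros H. revert g g'. induction H as [f|l f h h' _ IH d]; intros g g' hg.
  - inversion hg; subst. apply nth_deriv0.
  - inversion hg as [|l' g0 k k' hk dk]; subst.
    apply (nth_derivS _ _ _ _ (IH _ _ hk)). intros x.
    destruct (d x), (dk x). split; now apply derivable_pt_lim_plus.
Qed.

Lemma CkT_add_bump (k : ext_nat) (t0 c : R) (u : R -> C) :
  CkT k u -> CkT k (fun t => u t + RtoC c * bump t0 t)%C.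
Proof.
  intros [per diff]. split.
  - intros t. now rewrite per, bump_periodic.
  - intros l hl. destruct (diff l hl) as [h [dh ch]].
    destruct (bump_nth_deriv_continuous t0 l) as [b [db cb]].
    exists (fun t => h t + RtoC c * b t)%C. split.
    + apply nth_deriv_plus; [exact dh | now apply nth_deriv_scal].
    + apply Ccontinuous_plus; [exact ch|].
      apply Ccontinuous_mult; [apply Ccontinuous_const | exact cb].
Qed.

(** The two expansions are brought to M = max(M1, M2), which shrinks the arc and enlarges both
    remainder bounds. Their difference is an expansion of c times the bump with constant 2 M, so the
    bump would vanish on the arc, against [bump_neq0] at a short nonzero chord. *)
Lemma expands_add_bump (t0 c M1 M2 : R) (u : R -> C) (a b : nat -> C) :
  0 < M1 -> 0 < M2 -> 0 < c ->
  expands M1 (expi t0) u a ->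
  expands M2 (expi t0) (fun t => u t + RtoC c * bump t0 t)%C b -> False.
Proof.
  intros h1 h2 hc [_ e1] [_ e2].
  set (M := Rmax M1 M2).
  assert (m1 : M1 <= M) by apply Rmax_l. assert (m2 : M2 <= M) by apply Rmax_r.
  assert (hM : 0 < M) by lra.
  assert (mc : Cmod (RtoC c) = c) by (rewrite Cmod_R, Rabs_pos_eq; lra).
  assert (dM : forall M', 0 < M' -> M' <= M -> / (8 * M) <= / (8 * M')).
  { intros. apply Rinv_le_contravar; lra. }
  assert (G : geometric_remainder t0 M (2 * M) (fun t => RtoC c * bump t0 t)%C
                (fun n => b n - a n)%C).
  { intros t ht N.
    specialize (e1 t). specialize (e2 t). fold (chord t0 t) in e1, e2.
    specialize (e1 (Rlt_le_trans _ _ _ ht (dM _ h1 m1)) N).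
    specialize (e2 (Rlt_le_trans _ _ _ ht (dM _ h2 m2)) N).
    assert (p := Cmod_ge_0 (chord t0 t)).
    assert (up : forall M', 0 < M' -> M' <= M ->
      M' * (M' * Cmod (chord t0 t)) ^ N <= M * (M * Cmod (chord t0 t)) ^ N).
    { intros M' hM' hM''. apply Rmult_le_compat; [lra| |exact hM''|].
      - apply pow_le. nra.
      - apply pow_incr. nra. }
    assert (u1 := up _ h1 m1). assert (u2 := up _ h2 m2).
    rewrite (csum_ext _ (fun i => b i * chord t0 t ^ i - a i * chord t0 t ^ i)%C)
      by (intros; ring).
    rewrite csum_minus.
    match type of e1 with Cmod (_ - ?x) <= _ => set (s1 := x) in * end.
    match type of e2 with Cmod (_ - ?x) <= _ => set (s2 := x) in * end.
    replace (RtoC c * bump t0 t - (s2 - s1))%C with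
      ((u t + RtoC c * bump t0 t - s2) - (u t - s1))%C by ring.
    eapply Rle_trans; [apply Cmod_minus|]. lra. }
  destruct (short_chord_exists t0 (/ (16 * M))) as [t [ht1 ht2]].
  { apply Rinv_0_lt_compat. lra. }
  fold (chord t0 t) in ht1, ht2.
  assert (Z : Cmod (RtoC c * bump t0 t) <= 0).
  { apply (flat_expansion_vanishes t0 M (2 * M) hM ltac:(lra) _ _ G).
    - intros n. destruct (bump_flat_at t0 n) as [B hB]. exists (c * B). intros s hs.
      rewrite Cmod_mult, mc, Rmult_assoc. apply Rmult_le_compat_l; [lra|]. now apply hB.
    - eapply Rle_lt_trans; [exact ht2|]. apply Rinv_lt_contravar; nra. }
  rewrite Cmod_mult, mc in Z. assert (q := bump_neq0 t0 t ht1). nra.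
Qed.

Lemma U5_iff_not_expands (z0 : C) (k : ext_nat) (u : R -> C) :
  CkT k u -> (U5 z0 k u <-> forall n, ~ exists a, expands (INR (S n)) z0 u a).
Proof.
  intros hk. split.
  - intros [_ H] n [a ha]. apply H.
    assert (hn : 0 < INR (S n)) by (apply lt_0_INR; lia).
    destruct (expands_holomorphic _ _ _ _ hn ha) as [F [hF1 hF2]].
    exists (/ (8 * INR (S n))). split; [apply Rinv_0_lt_compat; lra|].
    now exists F.
  - intros H. split; [exact hk|]. intros [r [hr [F [hF1 hF2]]]].
    destruct (holomorphic_expands z0 r F u hr hF1 hF2) as [n hn].
    exact (H n hn).
Qed.

Lemma U5_Gdelta (t0 : R) (k : ext_nat) : Gdelta_in_Ck k (U5 (expi t0) k).
Proof.
  exists (fun n u => ~ exists a, expands (INR (S n)) (expi t0) u a). split.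
  - intros n u hk hu. apply NNPP. intros hno. apply hu.
    apply expands_closed; [apply lt_0_INR; lia|].
    (* The neighbourhood sought is a ball for the seminorm of order 0, present for every k. If each
       such ball met the functions expandable with this constant, u would be a uniform limit of
       them. *)
    intros eps he. apply NNPP. intros hv. apply hno. exists O, eps. split; [exact he|].
    intros v hkv hb [a ha]. apply hv. exists v, a. split; [|exact ha].
    destruct (hb O (le_n O)) as [h [dh [M [hM bh]]]].
    { destruct k; simpl; [lia | exact I]. }
    inversion dh; subst. intros t. specialize (bh t). rewrite Cnorm_Cmod in bh.
    change Csub with Cminus in bh. lra.
  - intros u hk. apply (U5_iff_not_expands _ _ _ hk).
Qed.

Lemma U5_dense (t0 : R) (k : ext_nat) : dense_in_Ck k (U5 (expi t0) k).
Proof.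
  intros O hO [u [hk hu]].
  destruct (classic (U5 (expi t0) k u)) as [hU|hU]; [now exists u|].
  destruct (hO u hk hu) as (N & eps & he & hball).
  destruct (bump_derivatives_bounded t0 N) as [B [hB hb]].
  (* With c B = eps / 2 all derivatives up to order N stay under a bound strictly below eps, as
     [ck_ball] demands. *)
  set (c := eps / (2 * B)). assert (hc : 0 < c) by (apply Rdiv_lt_0_compat; lra).
  set (v := fun t => (u t + RtoC c * bump t0 t)%C).
  assert (hv : CkT k v) by now apply CkT_add_bump.
  exists v. split; [exact hv|]. split.
  - apply hball; [exact hv|]. intros l hl _.
    destruct (hb l hl) as [h [dh bh]].
    exists (fun t => RtoC c * h t)%C. split.
    + replace (fun t => Csub (v t) (u t)) with (fun t => RtoC c * bump t0 t)%C.
      * now apply nth_deriv_scal.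
      * apply functional_extensionality. intros t. unfold v. change Csub with Cminus. ring.
    + exists (eps / 2). split; [lra|]. intros t. rewrite Cnorm_Cmod, Cmod_mult, Cmod_R.
      rewrite Rabs_pos_eq by lra. specialize (bh t).
      apply (Rmult_le_compat_l c) in bh; [|lra].
      replace (c * B) with (eps / 2) in bh by (unfold c; field; lra). exact bh.
  (* Since u and v cannot both expand, an expansion of v would put u in [U5], contrary to [hU]. *)
  - apply (U5_iff_not_expands _ _ _ hv). intros n [b hb2]. apply hU.
    apply (U5_iff_not_expands _ _ _ hk). intros m [a ha].
    apply (expands_add_bump t0 c (INR (S m)) (INR (S n)) u a b); auto; apply lt_0_INR; lia.
Qed.

Theorem theorem3p17 (z0 : Cx) (k : ext_nat) (hz0 : Cnorm z0 = 1) :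
  dense_in_Ck k (U5 z0 k) /\ Gdelta_in_Ck k (U5 z0 k).
Proof.
  rewrite Cnorm_Cmod in hz0. destruct (unit_circle_angle z0 hz0) as [t0 [_ <-]].
  split; [apply U5_dense | apply U5_Gdelta].
Qed.
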